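(* Let $M^5_{\sf c}\subset\mathbb C^4$ be the cubic model $w_1-\overline w_1=2iz\overline z$, $w_2-\overline w_2=2iz\overline z(z+\overline z)$, $w_3-\overline w_3=2z\overline z(z-\overline z)$, and let ${M'}^5\subset\mathbb C^4$ be any maximally minimal real analytic CR-generic $5$-dimensional submanifold. The initial ambiguity matrix associated to the local biholomorphic equivalence problem between $M^5_{\sf c}$ and ${M'}^5$ is of the general form $$\begin{pmatrix}\mathsf a\overline{\mathsf a}\overline{\mathsf a}&0&\overline{\mathsf c}&\overline{\mathsf e}&\overline{\mathsf d}\\0&\mathsf a\mathsf a\overline{\mathsf a}&\mathsf c&\mathsf d&\mathsf e\\0&0&\mathsf a\overline{\mathsf a}&\overline{\mathsf b}&\mathsf b\\0&0&0&\overline{\mathsf a}&0\\0&0&0&0&\mathsf a\end{pmatrix},$$ where $\mathsf a\neq0,\mathsf b,\mathsf c,\mathsf d,\mathsf e$ are complex numbers; that is, for every local biholomorphism $h$ mapping $M^5_{\sf c}$ to ${M'}^5$ there are complex-valued functions $\mathsf a,\mathsf b,\mathsf c,\mathsf d,\mathsf e$ on ${M'}^5$, with $\mathsf a$ nowhere zero, such that $$h_*\begin{pmatrix}\overline{\mathcal S}\\\mathcal S\\\mathcal T\\\overline{\mathcal L}\\\mathcal L\end{pmatrix}=\begin{pmatrix}\mathsf a\overline{\mathsf a}\overline{\mathsf a}&0&\overline{\mathsf c}&\overline{\mathsf e}&\overline{\mathsf d}\\0&\mathsf a\mathsf a\overline{\mathsf a}&\mathsf c&\mathsf d&\mathsf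 e\\0&0&\mathsf a\overline{\mathsf a}&\overline{\mathsf b}&\mathsf b\\0&0&0&\overline{\mathsf a}&0\\0&0&0&0&\mathsf a\end{pmatrix}\begin{pmatrix}\overline{\mathcal S}'\\\mathcal S'\\\mathcal T'\\\overline{\mathcal L}'\\\mathcal L'\end{pmatrix}.$$ Moreover, the collection of all matrices of this form, with $\mathsf a,\mathsf b,\mathsf c,\mathsf d,\mathsf e\in\mathbb C$ and $\mathsf a\neq0$, makes up a real $10$-dimensional matrix Lie subgroup of $\mathsf{GL}_5(\mathbb C)$.
   Context: On a $5$-dimensional real analytic CR-generic submanifold $M\subset\mathbb C^4$ of codimension $3$ (CR dimension $1$) with a chosen local generator $\mathcal L$ of $T^{1,0}M$, set $\mathcal T:=i[\mathcal L,\overline{\mathcal L}]$, $\mathcal S:=[\mathcal L,\mathcal T]$, $\overline{\mathcal S}:=[\overline{\mathcal L},\mathcal T]$. $M$ is maximally minimal if $\{\overline{\mathcal S},\mathcal S,\mathcal T,\overline{\mathcal L},\mathcal L\}$ is a frame for $\mathbb C\otimes_{\mathbb R}TM$. Unprimed fields refer to $M^5_{\sf c}$ and primed fields to ${M'}^5$. The initial ambiguity matrix is the general form of the transition matrix between the pushed-forward frame of the source and the frame of the target under a local biholomorphic equivalence. *)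

(* Defs.v *)
From HB Require Import structures.
From mathcomp Require Import all_boot all_order all_algebra.
From mathcomp Require Import complex.
From mathcomp Require Import all_classical all_reals all_analysis.

Set Implicit Arguments.
Unset Strict Implicit.
Unset Printing Implicit Defensive.

Import Order.TTheory GRing.Theory Num.Theory numFieldNormedType.Exports.

Local Open Scope classical_set_scope.
Local Open Scope ring_scope.

(* Conventions.  C^n is identified with R^(n + n) through z_j = x_j + i y_j,
   the coordinates being listed as (x_1, .., x_n, y_1, .., y_n).  A complex
   tangent vector of R^N, i.e. an element of C (x) T_p R^N, is the row vector of
   its coefficients on d/dx_1, .., d/dx_N; conjugation is then entrywise.       *)

Section Analytic.
Variables (K : numFieldType) (N : nat).

Definition monomial (x : 'rV[K]_N) (al : {ffun 'I_N -> nat}) : K :=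
  \prod_i x 0 i ^+ al i.

(* Sum over the multi-indices of length k: their entries are at most k. *)
Definition sum_degree (k : nat) (t : {ffun 'I_N -> nat} -> K) : K :=
  \sum_(al : {ffun 'I_N -> 'I_k.+1} | (\sum_i al i == k)%N)
     t [ffun i => al i : nat].

(* f is the sum of an absolutely convergent power series on a polydisc centred
   at p: real analyticity for K = R, holomorphy for K = C. *)
Definition analytic_at (f : 'rV[K]_N -> K) (p : 'rV[K]_N) : Prop :=
  exists (c : {ffun 'I_N -> nat} -> K) (r : K), 0 < r /\
    forall x : 'rV[K]_N, (forall i, `|x 0 i - p 0 i| < r) ->
      cvgn (series (fun k => sum_degree k (fun al => `|c al * monomial (x - p) al|)))
      /\ series (fun k => sum_degree k (fun al => c al * monomial (x - p) al)) @ \oo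
           --> f x.

End Analytic.

Section RealGeometry.
Variables (R : realType).
Local Notation C := R[i].

Definition complex_analytic_at N (f : 'rV[R]_N -> C) (p : 'rV[R]_N) : Prop :=
  analytic_at (fun x => complex.Re (f x)) p /\
  analytic_at (fun x => complex.Im (f x)) p.

(* Embedded d-dimensional real analytic submanifold of R^N: near each of its
   points M is the image of an analytic immersion which is a homeomorphism
   (with inverse psi) onto an open part of M. *)
Definition analytic_submanifold N (d : nat) (M : set 'rV[R]_N) : Prop :=
  forall p, M p ->
  exists (U : set 'rV[R]_N) (V : set 'rV[R]_d)
         (phi : 'rV[R]_d -> 'rV[R]_N) (psi : 'rV[R]_N -> 'rV[R]_d),
  [/\ [/\ open U, U p & open V],
      forall x, V x -> forall k, analytic_at (fun y => phi y 0 k) x,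
      forall x, V x -> forall v, 'D_v phi x = 0 -> v = 0,
      phi @` V = M `&` U &
      {within M `&` U, continuous psi} /\ forall x, V x -> psi (phi x) = x].

Section TangentVectors.
Variables (N : nat) (M : set 'rV[R]_N).

(* Velocities of the curves drawn on M. *)
Definition tangent (p v : 'rV[R]_N) : Prop :=
  exists gamma : R -> 'rV[R]_N,
    [/\ gamma 0 = p, \forall t \near (0 : R), M (gamma t)
      & is_derive (0 : R) (1 : R) gamma v].

Definition complex_tangent (p : 'rV[R]_N) (X : 'rV[C]_N) : Prop :=
  exists v w, [/\ tangent p v, tangent p w &
    X = map_mx (real_complex R) v + 'i%C *: map_mx (real_complex R) w].

Definition dirderiv (f : 'rV[R]_N -> C) (p v : 'rV[R]_N) : C :=
  ('D_v (fun x => complex.Re (f x)) p +i* 'D_v (fun x => complex.Im (f x)) p)%C.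

Definition apply_vect (X : 'rV[C]_N) (f : 'rV[R]_N -> C) (p : 'rV[R]_N) : C :=
  \sum_k X 0 k * dirderiv f p (delta_mx 0 k).

Definition local_extension (f : 'rV[R]_N -> C) (p : 'rV[R]_N)
    (F : 'rV[R]_N -> C) : Prop :=
  [/\ differentiable (fun x => complex.Re (F x)) p,
      differentiable (fun x => complex.Im (F x)) p
    & \forall q \near p, M q -> F q = f q].

(* X f for X complex tangent to M at p and f a function on M: any extension of
   f differentiable at p gives the same value (tangential_derivE). *)
Definition tangential_deriv (X : 'rV[C]_N) (f : 'rV[R]_N -> C)
    (p : 'rV[R]_N) : C :=
  apply_vect X (xget f [set F | local_extension f p F]) p.

(* Complex vector fields on M; only their values on M are relevant. *)
Definition vfield := 'rV[R]_N -> 'rV[C]_N.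

Definition conj_field (X : vfield) : vfield := fun p => map_mx conjc (X p).

Definition lie_bracket (X Y : vfield) : vfield := fun p =>
  \row_k (tangential_deriv (X p) (fun q => Y q 0 k) p
          - tangential_deriv (Y p) (fun q => X q 0 k) p).

Definition analytic_along (f : 'rV[R]_N -> C) (p : 'rV[R]_N) : Prop :=
  exists F, complex_analytic_at F p /\ \forall q \near p, M q -> F q = f q.

End TangentVectors.

Section TangentialDerivative.
Variables (N : nat) (M : set 'rV[R]_N).
Implicit Types (p v w : 'rV[R]_N) (f F : 'rV[R]_N -> R[i]).

Lemma derive_sum_coord (u : 'rV[R]_N -> R) p v : differentiable u p ->
  'D_v u p = \sum_k v 0 k * 'D_(delta_mx 0 k) u p.
Proof.
move=> du; rewrite deriveE // [v in LHS]row_sum_delta linear_sum /=.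
by apply: eq_bigr => k _; rewrite linearZ /= deriveE.
Qed.

Lemma derive_along_curve (u : 'rV[R]_N -> R) p v (gamma : R -> 'rV[R]_N) :
  differentiable u p -> gamma 0 = p -> is_derive (0 : R) (1 : R) gamma v ->
  'D_1 (u \o gamma) 0 = 'D_v u p.
Proof.
move=> du g0 [dg dv].
have dg' : differentiable gamma 0 by apply/derivable1_diffP.
rewrite -g0 in du *.
rewrite deriveE; last exact: differentiable_comp.
by rewrite diff_comp //= deriveE // -dv deriveE.
Qed.

Lemma derive_tangent (u u' : 'rV[R]_N -> R) p v : tangent M p v ->
  differentiable u p -> differentiable u' p ->
  (\forall q \near p, M q -> u q = u' q) -> 'D_v u p = 'D_v u' p.
Proof.
move=> [gamma [g0 gM dg]] du du' uu'.
rewrite -(derive_along_curve du g0 dg) -(derive_along_curve du' g0 dg).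
apply: near_eq_derive => /=; rewrite ?oner_eq0 ?oner_neq0 //.
have cg : gamma @ (0 : R) --> gamma 0.
  by apply: differentiable_continuous; apply/derivable1_diffP; case: dg.
rewrite -g0 in uu'.
have := cg _ uu'; rewrite /= nbhs_simpl /= => H.
by near=> t; apply: (near H t) => //; near: t.
Unshelve. all: by end_near.
Qed.

Lemma tangential_derivE X f F p :
  complex_tangent M p X -> local_extension M f p F ->
  tangential_deriv M X f p = apply_vect X F p.
Proof.
move=> [v [w [tv tw ->]]] eF; rewrite /tangential_deriv.
have [F0r F0i F0f] : local_extension M f p (xget f [set F | local_extension M f p F]).
  by case: xgetP => [G _ //|/(_ F)]; case.
set F0 := xget _ _ in F0r F0i F0f *; case: eF => Fr Fi Ff.
have near_eq : \forall q \near p, M q -> F0 q = F q.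
  by near=> q => Mq; rewrite (near F0f q) ?(near Ff q).
have dirE u : tangent M p u -> dirderiv F0 p u = dirderiv F p u.
  move=> tu; congr (_ +i* _)%C; apply: derive_tangent => //;
  by near=> q => Mq; rewrite (near near_eq q).
have dirsum G (u : 'rV[R]_N) : differentiable (fun x => complex.Re (G x)) p ->
    differentiable (fun x => complex.Im (G x)) p ->
    \sum_k (u 0 k)%:C%C * dirderiv G p (delta_mx 0 k) = dirderiv G p u.
  move=> Gr Gi; rewrite /dirderiv (derive_sum_coord u Gr) (derive_sum_coord u Gi).
  apply/eqP; rewrite eq_complex !raddf_sum /=; apply/andP; split; apply/eqP;
  by apply: eq_bigr => k _ /=; rewrite mul0r ?subr0 ?addr0.
have applyE G : differentiable (fun x => complex.Re (G x)) p ->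
    differentiable (fun x => complex.Im (G x)) p ->
    apply_vect (map_mx (real_complex R) v + 'i%C *: map_mx (real_complex R) w) G p
    = dirderiv G p v + 'i%C * dirderiv G p w.
  move=> Gr Gi; rewrite -!dirsum // mulr_sumr -big_split /=.
  by apply: eq_bigr => k _; rewrite !mxE mulrDl mulrA.
by rewrite !applyE // !dirE.
Unshelve. all: by end_near.
Qed.
End TangentialDerivative.

(* (h_* X)(q) = dh (X (g q)), where g is the inverse of h. *)
Definition push_field N (h g : 'rV[R]_N -> 'rV[R]_N) (X : vfield N) :
    vfield N :=
  fun q => \row_k apply_vect (X (g q)) (fun x => (h x 0 k)%:C%C) (g q).

End RealGeometry.

Section CRGeometry.
Variables (R : realType) (n : nat).
Local Notation C := R[i].

Definition to_complex (x : 'rV[R]_(n + n)) : 'rV[C]_n :=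
  \row_j (x 0 (lshift n j) +i* x 0 (rshift n j))%C.

Definition of_complex (z : 'rV[C]_n) : 'rV[R]_(n + n) :=
  row_mx (map_mx (@complex.Re R) z) (map_mx (@complex.Im R) z).

Definition holomorphic_at (f : 'rV[R]_(n + n) -> C) (p : 'rV[R]_(n + n)) : Prop :=
  analytic_at (fun z => f (of_complex z)) (to_complex p).

Definition holomorphic_map (U : set 'rV[R]_(n + n))
    (h : 'rV[R]_(n + n) -> 'rV[R]_(n + n)) : Prop :=
  forall p, U p -> forall j, holomorphic_at (fun x => to_complex (h x) 0 j) p.

Definition biholomorphism (U U' : set 'rV[R]_(n + n))
    (h g : 'rV[R]_(n + n) -> 'rV[R]_(n + n)) : Prop :=
  [/\ open U /\ open U', h @` U = U', forall x, U x -> g (h x) = x,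
      holomorphic_map U h & holomorphic_map U' g].

(* The complex structure: J d/dx_j = d/dy_j and J d/dy_j = - d/dx_j. *)
Definition Jstruct (A : zmodType) (X : 'rV[A]_(n + n)) : 'rV[A]_(n + n) :=
  row_mx (- rsubmx X) (lsubmx X).

Variable M : set 'rV[R]_(n + n).

(* T_p M + J T_p M = T_p C^n. *)
Definition CR_generic : Prop := forall p, M p -> forall v,
  exists u w, [/\ tangent M p u, tangent M p w & v = u + Jstruct w].

Definition T10 (p : 'rV[R]_(n + n)) (X : 'rV[C]_(n + n)) : Prop :=
  complex_tangent M p X /\ Jstruct X = 'i%C *: X.

(* L is a real analytic generator of T^{1,0} M over the open subset M `&` U of
   M; this contains that T^{1,0} M has complex rank 1 there. *)
Definition T10_generator (U : set 'rV[R]_(n + n)) (L : vfield R (n + n)) : Prop :=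
  open U /\ forall p, M p -> U p ->
    [/\ forall k, analytic_along M (fun q => L q 0 k) p, L p != 0
      & forall X, T10 p X <-> exists lambda : C, X = lambda *: L p].

Definition Tfield (L : vfield R (n + n)) : vfield R (n + n) :=
  fun p => 'i%C *: lie_bracket M L (conj_field L) p.

Definition Sfield (L : vfield R (n + n)) : vfield R (n + n) :=
  lie_bracket M L (Tfield L).

Definition Sbfield (L : vfield R (n + n)) : vfield R (n + n) :=
  lie_bracket M (conj_field L) (Tfield L).

Definition frame (L : vfield R (n + n)) : 5.-tuple (vfield R (n + n)) :=
  [tuple Sbfield L; Sfield L; Tfield L; conj_field L; L].

Definition frame_mx (F : 5.-tuple (vfield R (n + n))) (p : 'rV[R]_(n + n)) :
    'M[C]_(5, n + n) :=
  \matrix_(i, j) tnth F i p 0 j.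

(* The rows of frame_mx F p form a basis of C (x) T_p M. *)
Definition is_frame_at (F : 5.-tuple (vfield R (n + n))) (p : 'rV[R]_(n + n)) :
    Prop :=
  row_free (frame_mx F p) /\
  forall X, complex_tangent M p X <-> (X <= frame_mx F p)%MS.

Definition maximally_minimal : Prop := forall p, M p ->
  exists U L, [/\ U p, T10_generator U L
    & forall q, M q -> U q -> is_frame_at (frame L) q].

End CRGeometry.

(* Coordinates (z, w_1, w_2, w_3) on C^4. *)
Definition cubic_model (R : realType) : set 'rV[R]_(4 + 4) :=
  [set x | let z := to_complex x 0 (inord 0) in
           let w1 := to_complex x 0 (inord 1) in
           let w2 := to_complex x 0 (inord 2) in
           let w3 := to_complex x 0 (inord 3) in
     [/\ w1 - conjc w1 = 2 * 'i%C * z * conjc z,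
         w2 - conjc w2 = 2 * 'i%C * z * conjc z * (z + conjc z)
       & w3 - conjc w3 = 2 * z * conjc z * (z - conjc z)]].

Definition ambiguity_mx (R : realType) (a b c d e : R[i]) : 'M[R[i]]_5 :=
  let x := @conjc R in
  \matrix_(i, j) nth 0 (nth [::]
    [:: [:: a * x a * x a; 0          ; x c    ; x e; x d];
        [:: 0            ; a * a * x a; c      ; d  ; e  ];
        [:: 0            ; 0          ; a * x a; x b; b  ];
        [:: 0            ; 0          ; 0      ; x a; 0  ];
        [:: 0            ; 0          ; 0      ; 0  ; a  ]] i) j.

Section MatrixLieGroups.
Variables (R : realType) (n : nat).

Definition mx_coords (A : 'M[R[i]]_n) : 'rV[R]_(n * n + n * n) :=
  of_complex (mxvec A).

Definition subgroup_of_GL (G : set 'M[R[i]]_n) : Prop :=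
  [/\ forall A, G A -> A \in unitmx, G 1%:M,
      forall A B, G A -> G B -> G (A *m B)
    & forall A, G A -> G (invmx A)].

Definition closed_in_GL (G : set 'M[R[i]]_n) : Prop :=
  exists2 F : set 'rV[R]_(n * n + n * n), closed F &
    forall A, A \in unitmx -> (G A <-> F (mx_coords A)).

(* A closed subgroup of GL_n(C) which is an embedded real analytic submanifold
   of real dimension d; product and inverse, being restrictions of those of
   GL_n(C), are then analytic. *)
Definition matrix_lie_subgroup (d : nat) (G : set 'M[R[i]]_n) : Prop :=
  [/\ subgroup_of_GL G, closed_in_GL G & analytic_submanifold d (mx_coords @` G)].

End MatrixLieGroups.

(* Main.v *)
(* Near a point of M' the two generators h_* L and L' of T^{1,0} M' are related by
   h_* L = a L'.  Since h_* commutes with brackets, the Leibniz rule gives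
   h_* T = i [a L', \bar a \bar L'] = a \bar a T' + \bar b \bar L' + b L' with
   b = - i \bar a \bar L'(a), and then h_* S = [a L', h_* T] = a a \bar a S' modulo
   T', \bar L', L', while the first row is the conjugate of the second because T is real.
   The brackets are computed with smooth extensions of the coefficients; that analytic
   functions are smooth and that h respects the complex structure comes from term-by-term
   differentiation of power series.
   That T' is tangent to M' follows from the frame of T^C M' given by maximal minimality,
   and T is tangent to the source because the inverse of h carries tangent vectors back.
   The matrices form the image of the polynomial embedding (a, .., e) |-> matrix, of
   which reading off five entries is a linear left inverse. *)

Require Import Defs.
From HB Require Import structures.
From mathcomp Require Import all_boot all_order all_algebra.
From mathcomp Require Import complex.
From mathcomp Require Import ring lra.
From mathcomp Require Import all_classical all_reals all_analysis.

Import Order.TTheory GRing.Theory Num.Theory numFieldNormedType.Exports.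

Set Implicit Arguments.
Unset Strict Implicit.
Unset Printing Implicit Defensive.

Local Open Scope classical_set_scope.
Local Open Scope ring_scope.

(** Two features of the definitions shape the argument. [tangential_deriv] picks some extension of a
    function given on [M], so its value is controlled only along a vector already known to lie in
    [complex_tangent]; every computation with brackets therefore has to establish tangency
    beforehand. And tangent vectors are velocities of curves on an arbitrary set, so their sums and
    multiples are not tangent by definition: linear algebra with them is done on [M'], where the
    frame spans exactly the tangent vectors. The ratio [a] is available only near a point, as a
    quotient of two coordinates; its derivatives enter [b], [c], [d], [e], so an open neighbourhood
    of each point is needed although the conclusion is pointwise. That [h_*] commutes with brackets
    rests on the symmetry of second derivatives, which is why the calculus starts there; and
    differentiating power series rests on Cauchy-type bounds for their homogeneous parts. *)

(** * Symmetry of second derivatives *)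

Section Calculus.
Context {R : realType}.

Lemma differentiable_approx (V W : normedModType R) (G : V -> W) (p : V) (e : R) :
  differentiable G p -> 0 < e ->
  \forall w \near (0 : V), `|G (p + w) - G p - 'D_w G p| <= e * `|w|.
Proof.
move=> dG e0.
have /eqaddoP/(_ _ e0) := diff_locally dG.
rewrite near_simpl; apply: filterS => w /=.
by rewrite deriveE// !fctE /= opprD addrA [w + p]addrC.
Qed.

Definition second_difference (V : normedModType R) (f : V -> R) (p u v : V) (s : R) :=
  f (p + s *: u + s *: v) - f (p + s *: u) - f (p + s *: v) + f p.

(** The mean value theorem along [u], applied to a difference of [f] at two points [s *: v] apart,
    turns the second difference into [s] times a difference of ['D_u f]; differentiability of
    ['D_u f] at the single point [p] then expands that difference to first order. *)
Lemma second_difference_approx (V : normedModType R) (f : V -> R) (p u v : V) (e : R) :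
  (\forall q \near p, differentiable f q) ->
  differentiable ('D_u f) p -> 0 < e ->
  \forall s \near 0^'+,
    `|second_difference f p u v s - s ^+ 2 * 'D_v ('D_u f) p| <= e * s ^+ 2.
Proof.
(* The two first-order errors have sizes [s * (|u| + |v|)] and [s * |u|]; [K] dominates their sum
   divided by [s], and the [1] keeps it positive. *)
move=> df dG e0; pose K := 2 * `|u| + `|v| + 1.
have K0 : 0 < K by rewrite ltr_pwDr// addr_ge0// mulr_ge0.
have eK0 : 0 < e / K by rewrite divr_gt0.
have /nbhs_ballP[r1 r10 H1] := df.
have /nbhs_ballP[r2 r20 H2] := differentiable_approx dG eK0.
near=> s.
have s0 : 0 < s by [].
have sr1 : s * K < r1.
  by rewrite -ltr_pdivlMr//; near: s; apply: nbhs_right_lt; rewrite divr_gt0.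
have sr2 : s * K < r2.
  by rewrite -ltr_pdivlMr//; near: s; apply: nbhs_right_lt; rewrite divr_gt0.
have bnd (c d : R) : 0 <= c <= s -> 0 <= d <= s -> `|c *: u + d *: v| <= s * (`|u| + `|v|).
  move=> /andP[c0 cs] /andP[d0 ds]; rewrite (le_trans (ler_normD _ _))//.
  rewrite !normrZ !ger0_norm// mulrDr lerD// ler_wpM2r//.
have bndK (c d : R) : 0 <= c <= s -> 0 <= d <= s -> `|c *: u + d *: v| < s * K.
  move=> cs ds; apply: le_lt_trans (bnd _ _ cs ds) _.
  rewrite ltr_pM2l// /K mulr2n mulrDl mul1r.
  by have := normr_ge0 u; have := normr_ge0 v; lra.
have dfc (c d : R) : 0 <= c <= s -> 0 <= d <= s -> differentiable f (p + (c *: u + d *: v)).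
  move=> cs ds; apply: H1; rewrite -ball_normE /ball_/= opprD addrA subrr sub0r normrN.
  by apply: lt_trans sr1; exact: bndK.
have ss : 0 <= s <= s by rewrite lexx ltW.
have os : 0 <= (0 : R) <= s by rewrite lexx ltW.
(* The term [0 *: v] is kept so that [dline] differentiates both halves. *)
pose phi t := f (p + (t *: u + s *: v)) - f (p + (t *: u + 0 *: v)).
pose dphi t := 'D_u f (p + (t *: u + s *: v)) - 'D_u f (p + (t *: u + 0 *: v)).
have dline (t d : R) : 0 <= t <= s -> 0 <= d <= s ->
   is_derive t 1 (fun t => f (p + (t *: u + d *: v))) ('D_u f (p + (t *: u + d *: v))).
  move=> tt dd.
  pose l (t : R) := p + (t *: u + d *: v).
  have dl : is_diff t l (fun x => x *: u).
    rewrite /l.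
    have h1 := is_diff_scalel t u.
    have h2 : is_diff t (fun t : R => t *: u + (p + d *: v)) (fun x => x *: u).
      have := @is_diffD _ _ _ _ _ _ _ _ h1 (is_diff_cst (p + d *: v) t).
      by rewrite addr0.
    rewrite (_ : (fun t : R => p + (t *: u + d *: v)) = (fun t : R => t *: u + (p + d *: v)))//.
    by apply/funext => x; rewrite addrCA.
  have dft := dfc _ _ tt dd.
  have dlt : differentiable l t by case: dl.
  apply: DeriveDef.
    apply/derivable1_diffP; exact: (differentiable_comp dlt).
  rewrite deriveE; last exact: (differentiable_comp dlt).
  rewrite (diff_comp dlt dft) /=.
  by rewrite [in RHS]deriveE// (@diff_val _ _ _ _ _ _ _ dl) scale1r.
have phid t : 0 <= t <= s -> is_derive t 1 phi (dphi t).
  by move=> tt; apply: is_deriveB; apply: dline.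
have [c /itvP cs Ec] : exists2 c, c \in `[0, s]%R & phi s - phi 0 = dphi c * (s - 0).
  apply: MVT_segment => [|x /itvP xs|]; first exact: ltW.
    by apply: phid; rewrite !xs.
  apply: derivable_within_continuous => x /itvP xs.
  by have [] : is_derive x 1 phi (dphi x) by apply: phid; rewrite !xs.
have c1 : 0 <= c <= s by rewrite !cs.
have -> : second_difference f p u v s = phi s - phi 0.
  rewrite /second_difference /phi !scale0r !addr0 !add0r !addrA opprB addrA.
  by rewrite addrAC -!addrA; congr (_ + (_ + _)); rewrite addrC.
rewrite Ec subr0.
have E1 := H2 (c *: u + s *: v); have E2 := H2 (c *: u + 0 *: v).
have {}E1 : `|'D_u f (p + (c *: u + s *: v)) - 'D_u f p - 'D_(c *: u + s *: v) ('D_u f) p|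
   <= e / K * (s * (`|u| + `|v|)).
  apply: (le_trans (E1 _)).
    rewrite -ball_normE /ball_/= sub0r normrN.
    by apply: lt_trans sr2; exact: bndK.
  by rewrite ler_wpM2l ?(ltW eK0)//; exact: bnd.
have {}E2 : `|'D_u f (p + (c *: u + 0 *: v)) - 'D_u f p - 'D_(c *: u + 0 *: v) ('D_u f) p|
   <= e / K * (s * `|u|).
  apply: (le_trans (E2 _)).
    rewrite -ball_normE /ball_/= sub0r normrN.
    by apply: lt_trans sr2; exact: bndK.
  rewrite ler_wpM2l ?(ltW eK0)// scale0r addr0 normrZ ler_wpM2r//.
  by rewrite ger0_norm// !cs.
set X := 'D_v ('D_u f) p; set Y := 'D_u ('D_u f) p.
have EL (a b : R) : 'D_(a *: u + b *: v) ('D_u f) p = a * Y + b * X.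
  by rewrite /X /Y !(deriveE _ dG) linearD !linearZ.
rewrite EL in E1; rewrite EL mul0r addr0 in E2.
rewrite /dphi.
set A := 'D_u f (p + (c *: u + s *: v)) in E1 *.
set B := 'D_u f (p + (c *: u + 0 *: v)) in E2 *.
(* The contributions [c * Y] of the unknown mean value point cancel, and only [s * X] survives. *)
have -> : (A - B) * s - s ^+ 2 * X =
  s * ((A - 'D_u f p - (c * Y + s * X)) - (B - 'D_u f p - c * Y)).
  by ring.
rewrite normrM (gtr0_norm s0).
have : `|A - 'D_u f p - (c * Y + s * X) - (B - 'D_u f p - c * Y)| <= e * s.
  rewrite (le_trans (ler_normB _ _))// (le_trans (lerD E1 E2))//.
  rewrite -mulrDr -mulrDr -mulrA ler_pM2l// mulrCA ger_pMr//.
  rewrite ler_pdivrMl// mulr1 /K; lra.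
move=> H; rewrite expr2 mulrA [e * s]mulrC -mulrA ler_pM2l//.
Unshelve. all: by end_near.
Qed.

(** The second difference is symmetric in [u] and [v], so both mixed derivatives approximate it
    after division by [s ^+ 2]; a common small [s > 0] puts them within any [e] of each other. *)
Lemma derive_symmetric (V : normedModType R) (f : V -> R) (p u v : V) :
  (\forall q \near p, differentiable f q) ->
  differentiable ('D_u f) p -> differentiable ('D_v f) p ->
  'D_v ('D_u f) p = 'D_u ('D_v f) p.
Proof.
move=> df du dv; apply/eqP; rewrite -subr_eq0 -normr_le0.
apply/ler_addgt0Pl => e e0; rewrite addr0.
have e20 : 0 < e / 2 by rewrite divr_gt0.
have N1 := second_difference_approx v df du e20.
have N2 := second_difference_approx u df dv e20.
have N3 : \forall s \near (0 : R)^'+, 0 < s by exact: nbhs_right_gt.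
have [s [[H1 H2] s0]] := @filter_ex _ _ (at_right_proper_filter 0) _ (filterI (filterI N1 N2) N3).
have E : second_difference f p u v s = second_difference f p v u s.
  by rewrite /second_difference [p + s *: v + _]addrAC; ring.
rewrite /= in H1 H2 s0; rewrite E distrC in H1.
have s2 : 0 < s ^+ 2 by rewrite exprn_gt0.
rewrite -(ler_pM2l s2) -{1}(gtr0_norm s2) -normrM mulrBr.
have := ler_normD (s ^+ 2 * 'D_v ('D_u f) p - second_difference f p v u s)
   (second_difference f p v u s - s ^+ 2 * 'D_u ('D_v f) p).
rewrite addrA subrK => /le_trans; apply.
apply: (le_trans (lerD H1 H2)); lra.
Qed.
End Calculus.

(** * Functions differentiable to all orders *)

Section Smooth.
Context {R : realType}.

(** Level [0] asks nothing, not even continuity: [Ck k] means that the partial derivatives of order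
    below [k] are differentiable near [p]. The grading serves for inductions; the class finally used
    is [smooth]. *)
Fixpoint Ck N (k : nat) (f : 'rV[R]_N -> R) (p : 'rV[R]_N) : Prop :=
  if k is k'.+1 then
    (\forall q \near p, differentiable f q) /\
    forall i, Ck k' ('D_(delta_mx 0 i) f) p
  else True.

Definition smooth N (f : 'rV[R]_N -> R) p := forall k, Ck k f p.

Lemma near_forall N (I : finType) (P : I -> 'rV[R]_N -> Prop) (p : 'rV[R]_N) :
  (forall i, \forall q \near p, P i q) -> \forall q \near p, forall i, P i q.
Proof. by move=> H; exact: (@filter_forall _ _ P _ _ H). Qed.

Lemma nearT N (P : 'rV[R]_N -> Prop) (p : 'rV[R]_N) :
  (forall q, P q) -> \forall q \near p, P q.
Proof. by move=> H; exact: (@filterE _ _ _ P H). Qed.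

Lemma nearS N (P Q : 'rV[R]_N -> Prop) (p : 'rV[R]_N) :
  (forall q, P q -> Q q) -> (\forall q \near p, P q) -> \forall q \near p, Q q.
Proof. by move=> PQ; exact: (@filterS _ _ _ P Q PQ). Qed.

Lemma nearS2 N (P P' Q : 'rV[R]_N -> Prop) (p : 'rV[R]_N) :
  (forall q, P q -> P' q -> Q q) -> (\forall q \near p, P q) ->
  (\forall q \near p, P' q) -> \forall q \near p, Q q.
Proof. by move=> PQ; exact: (@filterS2 _ _ _ P P' Q PQ). Qed.

Lemma near_eq_differentiable (V W : normedModType R) (f g : V -> W) p :
  (\forall q \near p, f q = g q) -> differentiable f p -> differentiable g p.
Proof.
move=> fg /diff_locallyP[cf ef]; have fgp := nbhs_singleton fg.
have dE : 'd g p = 'd f p :> (V -> W).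
  apply/diff_unique => //; apply/eqaddoP => e e0.
  have /eqaddoP/(_ _ e0) := ef.
  have : \forall h \near 0, f (h + p) = g (h + p).
    by move: fg; rewrite (near_shift 0 p) subr0.
  by apply: filterS2 => h /= E; rewrite !fctE /= E fgp.
apply/diff_locallyP; rewrite dE; split => //; apply/eqaddoP => e e0.
have /eqaddoP/(_ _ e0) := ef.
have : \forall h \near 0, f (h + p) = g (h + p).
  by move: fg; rewrite (near_shift 0 p) subr0.
by apply: filterS2 => h /= E; rewrite !fctE /= E fgp.
Qed.

Lemma near_eq_Ck N k (f g : 'rV[R]_N -> R) p :
  (\forall q \near p, f q = g q) -> Ck k f p -> Ck k g p.
Proof.
elim: k f g => // k IH f g fg [df Df]; have nfg := near_join fg; split.
  by apply: filterS2 nfg df => q; apply: near_eq_differentiable.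
move=> i; apply: IH (Df i); apply: filterS nfg => q; exact: near_eq_derive.
Qed.

Lemma CkW N k (f : 'rV[R]_N -> R) p : Ck k.+1 f p -> Ck k f p.
Proof.
elim: k f => // k IH f [df Df]; split => // i.
by apply: IH; exact: Df.
Qed.

Lemma Ck_cst N k (c : R) (p : 'rV[R]_N) : Ck k (fun=> c) p.
Proof.
elim: k c => // k IH c; split; first by near=> q; exact: differentiable_cst.
move=> i; apply: near_eq_Ck (IH 0).
by apply: nearT => q; rewrite derive_cst.
Unshelve. all: by end_near. Qed.

Lemma CkD N k (f g : 'rV[R]_N -> R) p :
  Ck k f p -> Ck k g p -> Ck k (fun x => f x + g x) p.
Proof.
elim: k f g => // k IH f g [df Df] [dg Dg]; split.
  by apply: nearS2 df dg => q fq gq; exact: (differentiableD fq gq).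
move=> i; apply: near_eq_Ck (IH _ _ (Df i) (Dg i)).
by apply: nearS2 df dg => q fq gq; rewrite (deriveD (diff_derivable fq) (diff_derivable gq)).
Qed.

Lemma CkM N k (f g : 'rV[R]_N -> R) p :
  Ck k f p -> Ck k g p -> Ck k (fun x => f x * g x) p.
Proof.
elim: k f g => // k IH f g Cf Cg; have [df Df] := Cf; have [dg Dg] := Cg; split.
  by apply: nearS2 df dg => q fq gq; exact: (differentiableM fq gq).
move=> i; apply: (@near_eq_Ck _ _
  (fun x => f x * 'D_(delta_mx 0 i) g x + g x * 'D_(delta_mx 0 i) f x)).
  by apply: nearS2 df dg => q fq gq; rewrite (deriveM (diff_derivable fq) (diff_derivable gq)).
by apply: CkD; apply: IH; [exact: CkW|exact: Dg|exact: CkW|exact: Df].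
Qed.

Lemma CkN N k (f : 'rV[R]_N -> R) p : Ck k f p -> Ck k (fun x => - f x) p.
Proof.
move=> Cf; apply: (@near_eq_Ck _ _ (fun x => -1 * f x)).
  by apply: nearT => q; rewrite mulN1r.
by apply: CkM => //; exact: Ck_cst.
Qed.

Lemma Ck_sum N k (I : Type) (r : seq I) (f : I -> 'rV[R]_N -> R) p :
  (forall i, Ck k (f i) p) -> Ck k (fun x => \sum_(i <- r) f i x) p.
Proof.
move=> Cf; elim: r => [|i r IH].
  apply: near_eq_Ck (Ck_cst _ 0 _).
  by apply: nearT => q; rewrite big_nil.
apply: near_eq_Ck (CkD (Cf i) IH).
by apply: nearT => q; rewrite big_cons.
Qed.

Lemma CkV N k (f : 'rV[R]_N -> R) p : f p != 0 ->
  Ck k f p -> Ck k (fun x => (f x)^-1) p.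
Proof.
move=> f0; elim: k => // k IH Cf; have [df Df] := Cf.
have fn0 : \forall q \near p, f q != 0.
  have cf : {for p, continuous f} by apply/differentiable_continuous/(nbhs_singleton df).
  have : \forall y \near f p, y != 0 by exact: open_nbhs_nbhs.
  by move=> /cf.
split; first by apply: nearS2 df fn0 => q; exact: differentiableV.
move=> i; apply: (@near_eq_Ck _ _ (fun x => - ((f x)^-1 * (f x)^-1 * 'D_(delta_mx 0 i) f x))).
  apply: nearS2 df fn0 => q fq q0; rewrite (deriveV q0 (diff_derivable fq)).
  by rewrite -exprVn expr2 scaleNr.
apply: CkN; apply: CkM; last by case: Cf => _; apply.
by apply: CkM; apply: IH; exact: CkW.
Qed.

Lemma differentiable_rV (V : normedModType R) N (h : V -> 'rV[R]_N) p :
  (forall j, differentiable (fun x => h x 0 j) p) -> differentiable h p.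
Proof.
move=> dh; rewrite (_ : h = \sum_(j < N) (fun x => h x 0 j *: (delta_mx 0 j : 'rV[R]_N))).
  by apply: differentiable_sum => j; exact: differentiableZl.
apply/funext => x; rewrite fct_sumE; exact: row_sum_delta.
Qed.

Lemma derive_rV (V : normedModType R) N (h : V -> 'rV[R]_N) p v j :
  differentiable h p -> 'D_v h p 0 j = 'D_v (fun x => h x 0 j) p.
Proof.
by move=> dh; rewrite derive_mx ?mxE//; exact: diff_derivable.
Qed.

Lemma derive_coord N i (p v : 'rV[R]_N) : 'D_v (fun x : 'rV[R]_N => x 0 i) p = v 0 i.
Proof. by rewrite -(@derive_rV _ _ id)// derive_id. Qed.

Lemma Ck_coord N k i (p : 'rV[R]_N) : Ck k (fun x => x 0 i) p.
Proof.
case: k => // k; split; first by apply: nearT => q; exact: differentiable_coord.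
move=> j; apply: near_eq_Ck (Ck_cst _ ((delta_mx 0 j : 'rV[R]_N) 0 i) _).
by apply: nearT => q; rewrite derive_coord.
Qed.

Lemma derive_comp (V W U : normedModType R) (f : W -> U) (h : V -> W) p v :
  differentiable h p -> differentiable f (h p) ->
  'D_v (f \o h) p = 'D_('D_v h p) f (h p).
Proof.
move=> dh df; rewrite !deriveE//; last exact: differentiable_comp.
by rewrite diff_comp.
Qed.

(** By the chain rule the partials of [f \o h] are sums of products of partials of [h] with partials
    of [f] composed with [h], one level lower; hence the induction generalizes [f] and keeps [h]
    fixed. *)
Lemma Ck_comp N N' k (f : 'rV[R]_N' -> R) (h : 'rV[R]_N -> 'rV[R]_N') p :
  (forall j, Ck k (fun x => h x 0 j) p) -> Ck k f (h p) -> Ck k (f \o h) p.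
Proof.
elim: k f => // k IH f Ch [df Df].
have dh : \forall q \near p, differentiable h q.
  have : \forall q \near p, forall j, differentiable (fun x => h x 0 j) q.
    by apply: near_forall => j; case: (Ch j).
  by apply: nearS => q; exact: differentiable_rV.
have ch : {for p, continuous h} by apply/differentiable_continuous/(nbhs_singleton dh).
have dfh : \forall q \near p, differentiable f (h q) := ch _ df.
split; first by apply: nearS2 dh dfh => q; exact: differentiable_comp.
move=> i; apply: (@near_eq_Ck _ _
  (fun x => \sum_j 'D_(delta_mx 0 i) (fun y => h y 0 j) x *
    ('D_(delta_mx 0 j) f \o h) x)).
  apply: nearS2 dh dfh => q hq fq; rewrite derive_comp//.
  rewrite (derive_sum_coord _ fq); apply: eq_bigr => j _.
  by rewrite derive_rV.
apply: Ck_sum => j; apply: CkM; first by case: (Ch j) => _; apply.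
by apply: IH; [move=> j'; exact: CkW|exact: Df].
Qed.

Lemma smooth_differentiable N (f : 'rV[R]_N -> R) p : smooth f p ->
  \forall q \near p, differentiable f q.
Proof. by move=> /(_ 1%N)[]. Qed.

Lemma smooth_derive N (f : 'rV[R]_N -> R) p v : smooth f p -> smooth ('D_v f) p.
Proof.
move=> sf k; have [df Df] := sf k.+1.
apply: (@near_eq_Ck _ _
  (fun x => \sum_j v 0 j * 'D_(delta_mx 0 j) f x)).
  by apply: nearS df => q fq; rewrite -derive_sum_coord.
by apply: Ck_sum => j; apply: CkM; [exact: Ck_cst|exact: Df].
Qed.

Lemma smooth_derive_symmetric N (f : 'rV[R]_N -> R) p u v : smooth f p ->
  'D_v ('D_u f) p = 'D_u ('D_v f) p.
Proof.
move=> sf; apply: derive_symmetric; first exact: smooth_differentiable.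
  exact: nbhs_singleton (smooth_differentiable (smooth_derive _ sf)).
exact: nbhs_singleton (smooth_differentiable (smooth_derive _ sf)).
Qed.

End Smooth.

(** * Homogeneous polynomials with a bound on their coefficients *)

Section HomogeneousPolynomial.
Context {K : numFieldType} {n : nat}.
Implicit Types (P Q : 'rV[K]_n -> K) (x y h : 'rV[K]_n).

(* [P] is a homogeneous polynomial of degree [k], in a Horner-like normal form, the
   absolute values of whose coefficients sum up to at most [M]. *)
Fixpoint hpoly (k : nat) (M : K) (P : 'rV[K]_n -> K) : Prop :=
  if k is k'.+1 then
    exists (Q : 'I_n -> 'rV[K]_n -> K) (m : 'I_n -> K),
      [/\ forall i, hpoly k' (m i) (Q i), \sum_i m i <= M
        & P = fun x => \sum_i x 0 i * Q i x]
  else exists2 c, `|c| <= M & P = fun=> c.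

Lemma hpoly_ge0 k M P : hpoly k M P -> 0 <= M.
Proof.
elim: k M P => [|k IH] M P; first by case=> c /(le_trans (normr_ge0 _)).
by case=> Q [m [HQ + _]]; apply: le_trans; apply: sumr_ge0 => i _; exact: IH (HQ i).
Qed.

Lemma hpolyW k M M' P : M <= M' -> hpoly k M P -> hpoly k M' P.
Proof.
case: k => [|k] MM'; first by case=> c cM ->; exists c => //; exact: le_trans MM'.
by case=> Q [m [HQ mM ->]]; exists Q, m; split => //; exact: le_trans MM'.
Qed.

Lemma hpoly0 k : hpoly k 0 (fun=> 0).
Proof.
elim: k => [|k IH]; first by exists 0; rewrite ?normr0.
exists (fun=> fun=> 0), (fun=> 0); split => //; first by rewrite big1.
by apply/funext => x; rewrite big1// => i _; rewrite mulr0.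
Qed.

Lemma hpolyD k M M' P P' : hpoly k M P -> hpoly k M' P' ->
  hpoly k (M + M') (fun x => P x + P' x).
Proof.
elim: k M M' P P' => [|k IH] M M' P P'.
  move=> [c cM ->] [c' cM' ->]; exists (c + c') => //.
  by rewrite (le_trans (ler_normD _ _))// lerD.
move=> [Q [m [HQ mM ->]]] [Q' [m' [HQ' mM' ->]]].
exists (fun i x => Q i x + Q' i x), (fun i => m i + m' i); split.
- by move=> i; exact: IH (HQ i) (HQ' i).
- by rewrite big_split lerD.
- by apply/funext => x; rewrite -big_split; apply: eq_bigr => i _; rewrite mulrDr.
Qed.

Lemma hpolyN k M P : hpoly k M P -> hpoly k M (fun x => - P x).
Proof.
elim: k M P => [|k IH] M P.
  by move=> [c cM ->]; exists (- c); rewrite ?normrN.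
move=> [Q [m [HQ mM ->]]]; exists (fun i x => - Q i x), m; split => //.
  by move=> i; exact: IH (HQ i).
by apply/funext => x; rewrite -sumrN; apply: eq_bigr => i _; rewrite mulrN.
Qed.

Lemma hpoly_sum k (I : Type) (r : seq I) (A : pred I) (M : I -> K) (P : I -> 'rV[K]_n -> K) :
  (forall i, A i -> hpoly k (M i) (P i)) ->
  hpoly k (\sum_(i <- r | A i) M i) (fun x => \sum_(i <- r | A i) P i x).
Proof.
move=> H; elim: r => [|i r IH].
  rewrite big_nil (_ : (fun _ => _) = fun=> 0); first exact: hpoly0.
  by apply/funext => x; rewrite big_nil.
rewrite big_cons (_ : (fun _ => _) = fun x => if A i then P i x + \sum_(j <- r | A j) P j x
  else \sum_(j <- r | A j) P j x); last by apply/funext => x; rewrite big_cons.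
by case: ifPn => // Ai; apply: hpolyD => //; exact: H.
Qed.

Lemma hpoly_monomial k c (al : {ffun 'I_n -> nat}) : (\sum_i al i)%N = k ->
  hpoly k `|c| (fun x => c * monomial x al).
Proof.
elim: k al => [|k IH] al alk.
  exists c => //; apply/funext => x; rewrite /monomial big1 ?mulr1// => i _.
  by move/eqP: alk; rewrite sum_nat_eq0 => /forallP/(_ i)/eqP ->.
have [i ali] : exists i, (0 < al i)%N.
  apply/existsP; apply: contraPT alk; rewrite negb_exists => /forallP H.
  by rewrite big1// => i _; move: (H i); rewrite -eqn0Ngt => /eqP.
(* One factor [x 0 i] is peeled off, which is the Horner-like form required. *)
pose al' : {ffun 'I_n -> nat} := [ffun j => if j == i then (al i).-1 else al j].
have alk' : (\sum_i al' i)%N = k.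
  have := alk; rewrite (bigD1 i)//= => H.
  rewrite (bigD1 i)//= ffunE eqxx.
  rewrite (eq_bigr (fun j => al j)); last by move=> j /negbTE ji; rewrite ffunE ji.
  by apply: succn_inj; rewrite -H -addSn prednK.
exists (fun j x => if j == i then c * monomial x al' else 0),
       (fun j => if j == i then `|c| else 0); split.
- by move=> j; case: eqP => _; [exact: IH|exact: hpoly0].
- by rewrite -big_mkcond big_pred1_eq.
- apply/funext => x; rewrite (bigD1 i)//= eqxx big1 ?addr0; last first.
    by move=> j /negbTE ->; rewrite mulr0.
  rewrite mulrCA; congr (_ * _).
  rewrite /monomial (bigD1 i)//= [in RHS](bigD1 i)//= mulrA ffunE eqxx -exprS prednK//.
  by congr (_ * _); apply: eq_bigr => j /negbTE ji; rewrite ffunE ji.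
Qed.

Lemma hpoly_sum_degree k (c : {ffun 'I_n -> nat} -> K) :
  hpoly k (sum_degree k (fun al => `|c al|))
          (fun x => sum_degree k (fun al => c al * monomial x al)).
Proof.
apply: hpoly_sum => al /eqP alk; apply: hpoly_monomial.
by rewrite -[RHS]alk; apply: eq_bigr => i _; rewrite ffunE.
Qed.

Lemma hpoly_le k M P t x : 0 <= t -> hpoly k M P -> (forall i, `|x 0 i| <= t) ->
  `|P x| <= M * t ^+ k.
Proof.
move=> t0 + xt; elim: k M P => [|k IH] M P; first by case=> c cM ->; rewrite expr0 mulr1.
case=> Q [m [HQ mM ->]]; apply: le_trans (ler_norm_sum _ _ _) _.
apply: (@le_trans _ _ (\sum_i m i * t ^+ k.+1)).
  apply: ler_sum => i _; rewrite normrM exprSr mulrA mulrC.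
  by apply: ler_pM => //; exact: IH (HQ i).
by rewrite -mulr_suml ler_wpM2r// exprn_ge0.
Qed.

(** This is the mean value bound [k * M * t ^ (k - 1) * s], multiplied by [t] so that no truncated
    exponent appears at [k = 0]. The induction is the product rule for differences. *)
Lemma hpoly_lipschitz k M P s t x h : 0 <= t -> 0 <= s -> hpoly k M P ->
  (forall i, `|x 0 i| <= t) -> (forall i, `|(x + h) 0 i| <= t) ->
  (forall i, `|h 0 i| <= s) ->
  `|P (x + h) - P x| * t <= k%:R * M * t ^+ k * s.
Proof.
move=> t0 s0 + xt xht hs; elim: k M P => [|k IH] M P.
  by case=> c cM ->; rewrite subrr normr0 !mul0r.
case=> Q [m [HQ mM ->]]; rewrite -sumrB.
apply: (@le_trans _ _ (\sum_i k.+1%:R * m i * t ^+ k.+1 * s)); last first.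
  by rewrite -!mulr_suml -mulr_sumr !ler_wpM2r// ?exprn_ge0// ler_wpM2l.
apply: le_trans (ler_wpM2r t0 (ler_norm_sum _ _ _)) _.
rewrite mulr_suml; apply: ler_sum => i _.
have -> : (x + h) 0 i * Q i (x + h) - x 0 i * Q i x =
   h 0 i * Q i (x + h) + x 0 i * (Q i (x + h) - Q i x).
  by rewrite mxE; ring.
apply: le_trans (ler_wpM2r t0 (ler_normD _ _)) _; rewrite mulrDl !normrM.
have -> : k.+1%:R * m i * t ^+ k.+1 * s = s * (m i * t ^+ k) * t + t * (k%:R * m i * t ^+ k * s).
  by rewrite -natr1 exprS; ring.
apply: lerD.
  apply: ler_wpM2r => //; apply: ler_pM => //; exact: hpoly_le (HQ i) _.
by rewrite -mulrA; apply: ler_pM => //; [exact: mulr_ge0|exact: IH (HQ i)].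
Qed.

(* The factor [t ^+ 2] replaces [t ^+ k.-1] on the right, which would be junk at [k = 0]. *)
Lemma hpoly_derivative k M P : hpoly k.+1 M P ->
  exists2 D : 'I_n -> 'rV[K]_n -> K, forall i, hpoly k (k.+1%:R * M) (D i) &
    forall s t x h, 0 <= t -> 0 <= s ->
      (forall i, `|x 0 i| <= t) -> (forall i, `|(x + h) 0 i| <= t) ->
      (forall i, `|h 0 i| <= s) ->
    `|P (x + h) - P x - \sum_i h 0 i * D i x| * t ^+ 2
       <= (k.+1 * k)%:R * M * t ^+ k.+1 * s ^+ 2.
Proof.
elim: k M P => [|k IH] M P [Q [m [HQ mM ->]]].
  (* In degree one the [Q i] are constants, so the expansion is exact. *)
  exists Q => [i|s t x h t0 s0 xt xht hs].
    apply: (@hpolyW 0 (m i)) (HQ i); rewrite mul1r; apply: le_trans mM.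
    by rewrite (bigD1 i)//= lerDl sumr_ge0// => j _; exact: (@hpoly_ge0 0 _ (Q j)) (HQ j).
  rewrite -!sumrB big1 ?normr0 ?muln0 ?mul0r// => i _.
  by case: (HQ i) => c _ ->; rewrite mxE; ring.
have /choice[DQ HDQ] : forall j, exists D : 'I_n -> 'rV[K]_n -> K,
    (forall i, hpoly k (k.+1%:R * m j) (D i)) /\
    forall s t x h, 0 <= t -> 0 <= s ->
      (forall i, `|x 0 i| <= t) -> (forall i, `|(x + h) 0 i| <= t) ->
      (forall i, `|h 0 i| <= s) ->
    `|Q j (x + h) - Q j x - \sum_i h 0 i * D i x| * t ^+ 2
       <= (k.+1 * k)%:R * m j * t ^+ k.+1 * s ^+ 2.
  by move=> j; have [D D1 D2] := IH _ _ (HQ j); exists D.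
(* Leibniz rule for [\sum_j x 0 j * Q j x]; the summand [Q i] accounts for the growth of the factor
   from [k + 1] to [k + 2]. *)
exists (fun i x => Q i x + \sum_j x 0 j * DQ j i x) => [i|s t x h t0 s0 xt xht hs].
  have : hpoly k.+1 (m i + \sum_j k.+1%:R * m j) (fun x => Q i x + \sum_j x 0 j * DQ j i x).
    apply: hpolyD; first exact: HQ.
    exists (fun j => DQ j i), (fun j => k.+1%:R * m j); split => // j.
    by case: (HDQ j).
  apply: hpolyW; rewrite -mulr_sumr -[k.+2]addn1 natrD mulrDl mul1r addrC lerD// ?ler_wpM2l//.
  apply: le_trans mM.
  by rewrite (bigD1 i)//= lerDl sumr_ge0// => j _; exact: (@hpoly_ge0 k.+1 _ (Q j)) (HQ j).
have -> : \sum_i (x + h) 0 i * Q i (x + h) - \sum_i x 0 i * Q i x -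
    \sum_i h 0 i * (Q i x + \sum_j x 0 j * DQ j i x) =
  \sum_j (x 0 j * (Q j (x + h) - Q j x - \sum_i h 0 i * DQ j i x)
           + h 0 j * (Q j (x + h) - Q j x)).
  have -> : \sum_i h 0 i * (Q i x + \sum_j x 0 j * DQ j i x) =
     \sum_j (h 0 j * Q j x + x 0 j * \sum_i h 0 i * DQ j i x).
    rewrite big_split /=; under eq_bigr do rewrite mulrDr mulr_sumr.
    rewrite big_split /=; congr (_ + _); rewrite exchange_big; apply: eq_bigr => i _.
    by rewrite mulr_sumr; apply: eq_bigr => j _; rewrite mulrCA.
  rewrite -!sumrB; apply: eq_bigr => j _; rewrite mxE.
  by set S := \sum_(_ < _) _; ring.
apply: (@le_trans _ _ (\sum_i (k.+2 * k.+1)%:R * m i * t ^+ k.+2 * s ^+ 2)); last first.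
  by rewrite -!mulr_suml -mulr_sumr !ler_wpM2r// ?exprn_ge0// ler_wpM2l.
apply: le_trans (ler_wpM2r (exprn_ge0 2 t0) (ler_norm_sum _ _ _)) _.
rewrite mulr_suml; apply: ler_sum => j _; have [_ rem] := HDQ j.
apply: le_trans (ler_wpM2r (exprn_ge0 2 t0) (ler_normD _ _)) _; rewrite mulrDl !normrM.
(* The split [(k + 2)(k + 1) = (k + 1) k + 2 (k + 1)]: the first part bounds the remainder of [Q j],
   and half of the second bounds the cross term [h 0 j * (Q j (x + h) - Q j x)]. *)
have -> : (k.+2 * k.+1)%:R * m j * t ^+ k.+2 * s ^+ 2 =
    t * ((k.+1 * k)%:R * m j * t ^+ k.+1 * s ^+ 2)
    + 2 * s * (k.+1%:R * m j * t ^+ k.+1 * s) * t.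
  rewrite [t ^+ k.+2]exprS !natrM -[k.+2]addn2 -[k.+1]addn1 !natrD; ring.
apply: lerD.
  by rewrite -mulrA; apply: ler_pM => //; [rewrite mulr_ge0// exprn_ge0|exact: rem].
have m0 : 0 <= m j := @hpoly_ge0 k.+1 _ (Q j) (HQ j).
apply: (@le_trans _ _ (s * (k.+1%:R * m j * t ^+ k.+1 * s) * t)); last first.
  rewrite ler_wpM2r// ler_wpM2r// ?ler_peMl// ?ler1n//.
  by rewrite !mulr_ge0// exprn_ge0.
rewrite expr2 mulrA ler_wpM2r// -mulrA; apply: ler_pM => //; first exact: mulr_ge0.
exact: (@hpoly_lipschitz k.+1 _ (Q j)).
Qed.

End HomogeneousPolynomial.

(** * Power series grouped by degree *)

Section HomogeneousSeries.
Context {K : numFieldType} {n : nat}.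

(* [B / r ^+ k] is a Cauchy-type bound on the coefficients of the degree [k] part. *)
Definition hseries (f : 'rV[K]_n -> K) (p : 'rV[K]_n) (P : nat -> 'rV[K]_n -> K) (B r : K) :=
  [/\ 0 < r, 0 <= B, forall k, hpoly k (B / r ^+ k) (P k)
    & forall x : 'rV[K]_n, (forall i, `|x 0 i - p 0 i| < r) ->
        series (fun k => P k (x - p)) @ \oo --> f x].

(** Cauchy's estimate. At the point whose coordinates are [p 0 i + r / 2] every monomial of degree
    [k] has the value [(r / 2) ^+ k]; absolute convergence there makes the sums of coefficients
    times [(r / 2) ^+ k] tend to zero, hence bounded by some [B]. *)
Lemma analytic_hseries f p : analytic_at f p -> exists P B r, hseries f p P B r.
Proof.
case=> c [r [r0 Hf]].
pose u (k : nat) := sum_degree k (fun al => `|c al|).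
have r20 : 0 < r / 2 by rewrite divr_gt0.
have u0 k : 0 <= u k by apply: sumr_ge0.
have cu : cvgn (series (fun k => u k * (r / 2) ^+ k)).
  have H i : `|(p + const_mx (r / 2)) 0 i - p 0 i| < r.
    by rewrite !mxE addrAC subrr add0r gtr0_norm// ltr_pdivrMr// ltr_pMr// ltr1n.
  have [+ _] := Hf _ H; set v := fun k => sum_degree _ _.
  rewrite (_ : v = fun k => u k * (r / 2) ^+ k)//; apply/funext => k.
  rewrite /v /u /sum_degree mulr_suml; apply: eq_bigr => al /eqP alk.
  rewrite normrM; congr (_ * _); rewrite /monomial normr_prod.
  rewrite (eq_bigr (fun i => (r / 2) ^+ al i)).
    by rewrite prodrXr alk.
  by move=> i _; rewrite ffunE !mxE addrAC subrr add0r normrX gtr0_norm.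
have [B [B0 HB]] : exists B, 0 <= B /\ forall k, u k * (r / 2) ^+ k <= B.
  have cu0 : cvgn (fun k => u k * (r / 2) ^+ k).
    have := cvg_series_cvg_0 cu; exact: cvgP.
  have /pinfty_ex_gt0 := cvg_seq_bounded cu0; move=> [B B0 HB]; exists B; split; first exact: ltW.
  by move=> k; apply: le_trans (HB k I); rewrite ger0_norm// mulr_ge0// exprn_ge0// ltW.
exists (fun k x => sum_degree k (fun al => c al * monomial x al)), B, (r / 2); split => //.
  move=> k; apply: hpolyW (hpoly_sum_degree _ _).
  by rewrite ler_pdivlMr ?exprn_gt0//; exact: HB.
move=> x xr; have [|_ ] := Hf x; last by [].
by move=> i; apply: lt_trans (xr i) _; rewrite ltr_pdivrMr// ltr_pMr// ltr1n.
Qed.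

End HomogeneousSeries.

(** * From complex to real power series *)

Section RealAndImaginaryParts.
Context {R : realType}.
Local Notation C := R[i].
Local Notation CN := (R[i] : numFieldType).

Lemma split_lshift m n (j : 'I_m) : fintype.split (lshift n j) = inl j.
Proof. exact: (unsplitK (inl j)). Qed.

Lemma split_rshift m n (j : 'I_n) : fintype.split (rshift m j) = inr j.
Proof. exact: (unsplitK (inr j)). Qed.

Lemma Re_le (z w : C) : z <= w -> complex.Re z <= complex.Re w.
Proof. by rewrite lecE => /andP[]. Qed.

Lemma Re_normc_ge (z : C) : `|complex.Re z| <= complex.Re `|z|.
Proof. by have := Re_le (normc_ge_Re z). Qed.

Lemma Im_normc_ge (z : C) : `|complex.Im z| <= complex.Re `|z|.
Proof.
have -> : complex.Im z = - complex.Re (z * 'i%C) by rewrite ReiNIm opprK.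
rewrite normrN (le_trans (Re_normc_ge _))// normrM.
have -> : `|'i%C : C| = 1 by rewrite normc_def /= expr0n expr1n add0r sqrtr1.
by rewrite mulr1.
Qed.

Lemma cvg_Re (u : nat -> CN) (l : CN) : u @ \oo --> l ->
  (fun k => complex.Re (u k)) @ \oo --> complex.Re l.
Proof.
move=> /cvgrPdist_lt H; apply/cvgrPdist_lt => e e0.
have e0' : (0 : C) < e%:C%C by rewrite ltcR.
have := H _ e0'; apply: filterS => k.
rewrite ltcE => /andP[_ /=]; apply: le_lt_trans.
by rewrite -raddfB; exact: Re_normc_ge.
Qed.

Lemma cvg_Im (u : nat -> CN) (l : CN) : u @ \oo --> l ->
  (fun k => complex.Im (u k)) @ \oo --> complex.Im l.
Proof.
move=> /cvgrPdist_lt H; apply/cvgrPdist_lt => e e0.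
have e0' : (0 : C) < e%:C%C by rewrite ltcR.
have := H _ e0'; apply: filterS => k.
rewrite ltcE => /andP[_ /=]; apply: le_lt_trans.
by rewrite -raddfB; exact: Im_normc_ge.
Qed.

Lemma to_complexE n (x : 'rV[R]_(n + n)) j :
  to_complex x 0 j = (x 0 (lshift n j) +i* x 0 (rshift n j))%C.
Proof. by rewrite mxE. Qed.

Lemma to_complexB n (x y : 'rV[R]_(n + n)) : to_complex (x - y) = to_complex x - to_complex y.
Proof. by apply/rowP => j; rewrite !mxE. Qed.

Lemma to_complexK n : cancel (@to_complex R n) (@of_complex R n).
Proof.
move=> x; apply/rowP => j; rewrite mxE; case: splitP => k jk.
  by rewrite !mxE /=; congr (x 0 _); apply/val_inj.
by rewrite !mxE /=; congr (x 0 _); apply/val_inj.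
Qed.

(** Multiplication by [z_j = x_j + i y_j] contributes one term in [x_j] and one in [y_j] to each of
    the real and imaginary parts, so the coefficient sum can double with every degree. *)
Lemma hpoly_Re_Im n k M (P : 'rV[C]_n -> C) : hpoly k M P ->
  hpoly k (2 ^+ k * complex.Re M) (fun x : 'rV[R]_(n + n) => complex.Re (P (to_complex x))) /\
  hpoly k (2 ^+ k * complex.Re M) (fun x : 'rV[R]_(n + n) => complex.Im (P (to_complex x))).
Proof.
elim: k M P => [|k IH] M P.
  move=> [c cM ->]; rewrite expr0 mul1r; split.
    exists (complex.Re c) => //; exact: le_trans (Re_normc_ge _) (Re_le cM).
  exists (complex.Im c) => //; exact: le_trans (Im_normc_ge _) (Re_le cM).
case=> Q [m [HQ mM ->]].
have bound : \sum_(i < n + n) 2 ^+ k * complex.Re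
      (m (match fintype.split i with inl j => j | inr j => j end))
   <= 2 ^+ k.+1 * complex.Re M.
  rewrite -mulr_sumr exprSr -mulrA ler_wpM2l ?exprn_ge0// big_split_ord /=.
  under eq_bigr do rewrite split_lshift.
  under [X in _ + X]eq_bigr do rewrite split_rshift.
  rewrite -mulr2n mulr_natl lerMn2r/= -raddf_sum; exact: Re_le.
have HR i := (IH _ _ (HQ i)).1.
have HI i := (IH _ _ (HQ i)).2.
have HIN i : hpoly k (2 ^+ k * complex.Re (m i))
    (fun x : 'rV[R]_(n + n) => - complex.Im (Q i (to_complex x))).
  exact: hpolyN.
split.
  exists (fun i x => match fintype.split i with inl j => complex.Re (Q j (to_complex x))
     | inr j => - complex.Im (Q j (to_complex x)) end).
  exists (fun i => 2 ^+ k * complex.Re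
      (m (match fintype.split i with inl j => j | inr j => j end))).
  split => //; first by move=> i; case: (fintype.split i).
  apply/funext => x; rewrite big_split_ord /= raddf_sum /= -big_split /=.
  apply: eq_bigr => i _; rewrite split_lshift split_rshift to_complexE /=.
  by case: (Q i _) => a b /=; rewrite mulrN.
exists (fun i x => match fintype.split i with inl j => complex.Im (Q j (to_complex x))
     | inr j => complex.Re (Q j (to_complex x)) end).
exists (fun i => 2 ^+ k * complex.Re
      (m (match fintype.split i with inl j => j | inr j => j end))).
split => //; first by move=> i; case: (fintype.split i).
apply/funext => x; rewrite big_split_ord /= raddf_sum /= -big_split /=.
apply: eq_bigr => i _; rewrite split_lshift split_rshift to_complexE /=.
by case: (Q i _) => a b /=.
Qed.

(** Halving the radius does two things: it absorbs the factor [2 ^+ k] from splitting into real and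
    imaginary parts, and it puts real coordinates within [r' / 2] of [p] inside the complex polydisc
    of radius [r']. The clause on [P 1%N] keeps the complex linearity from which the Cauchy-Riemann
    equations follow. *)
Lemma holomorphic_hseries n (f : 'rV[R]_(n + n) -> C) p : holomorphic_at f p ->
  exists P B r, [/\ forall v, P 1%N ('i%C *: v) = 'i%C * P 1%N v,
    hseries (fun x => complex.Re (f x)) p (fun k x => complex.Re (P k (to_complex x))) B r
  & hseries (fun x => complex.Im (f x)) p (fun k x => complex.Im (P k (to_complex x))) B r].
Proof.
move=> /analytic_hseries[P [B [r [r0 B0 HP cP]]]].
have [r' r0' rE] : exists2 r', 0 < r' & r = r'%:C%C.
  move: r0; rewrite ltcE => /andP[/eqP /= Ir Rr]; exists (complex.Re r) => //.
  by case: r Ir {Rr cP HP} => a b /= ->.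
have [B' B0' BE] : exists2 B', 0 <= B' & B = B'%:C%C.
  move: B0; rewrite lecE => /andP[/eqP /= IB RB]; exists (complex.Re B) => //.
  by case: B IB {RB cP HP} => a b /= ->.
exists P, B', (r' / 2).
have E k : 2 ^+ k * complex.Re (B / r ^+ k) = B' / (r' / 2) ^+ k.
  have -> : B / r ^+ k = (B' / r' ^+ k)%:C%C.
    by rewrite rE BE rmorphM fmorphV rmorphXn.
  rewrite /=.
  by rewrite expr_div_n invf_div mulrCA.
have cP' (x : 'rV[R]_(n + n)) : (forall i, `|x 0 i - p 0 i| < r' / 2) ->
    series (fun k => P k (to_complex (x - p))) @ \oo --> (f x : CN).
  move=> xp; rewrite to_complexB -[x in f x]to_complexK; apply: cP => j.
  have -> : to_complex x 0 j - to_complex p 0 j = ((x 0 (lshift n j) - p 0 (lshift n j))%:C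
      + 'i * (x 0 (rshift n j) - p 0 (rshift n j))%:C)%C.
    by rewrite !mxE; apply/eqP; rewrite eq_complex /=; apply/andP; split; apply/eqP; ring.
  rewrite rE; apply: le_lt_trans (ler_normD _ _) _.
  have ni : `|'i%C : C| = 1 by rewrite normc_def /= expr0n expr1n add0r sqrtr1.
  have nr (a : R) : `|a%:C%C : C| = `|a|%:C%C by rewrite normc_def /= expr0n addr0 sqrtr_sqr.
  by rewrite normrM ni mul1r !nr -rmorphD ltcR [r']splitr ltrD.
split.
- have [Q [m [HQ _ ->]]] := HP 1%N; move=> v; rewrite mulr_sumr; apply: eq_bigr => i _.
  by case: (HQ i) => c _ ->; rewrite mxE mulrA.
- split=> [||k|x xp]; rewrite ?divr_gt0//; first by rewrite -E; case: (hpoly_Re_Im (HP k)).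
  have := cvg_Re (cP' x xp); set u := fun k => _.
  rewrite (_ : u = series (fun k => complex.Re (P k (to_complex (x - p)))))//.
  by apply/funext => k; rewrite /u !seriesEnat /= raddf_sum.
- split=> [||k|x xp]; rewrite ?divr_gt0//; first by rewrite -E; case: (hpoly_Re_Im (HP k)).
  have := cvg_Im (cP' x xp); set u := fun k => _.
  rewrite (_ : u = series (fun k => complex.Im (P k (to_complex (x - p)))))//.
  by apply/funext => k; rewrite /u !seriesEnat /= raddf_sum.
Qed.

End RealAndImaginaryParts.

(** * Term-by-term differentiation *)

Section TermwiseDifferentiation.
Context {R : realType}.

Lemma coord_le_norm m n (x : 'M[R]_(m, n)) i j : `|x i j| <= `|x|.
Proof. by rewrite [leRHS]/Num.Def.normr/= mx_normrE; exact: (le_bigmax _ _ (i, j)). Qed.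

Lemma near_coord n (p : 'rV[R]_n) e : 0 < e ->
  \forall q \near p, forall i, `|(q : 'rV[R]_n) 0 i - p 0 i| < e.
Proof.
move=> e0; apply/nbhs_ballP; exists e => // q; rewrite -ball_normE /ball_/= => qe i.
apply: le_lt_trans qe; rewrite distrC.
by have := coord_le_norm (p - q) 0 i; rewrite !mxE.
Qed.

Lemma differentiable_quadratic n (f : 'rV[R]_n -> R) (q : 'rV[R]_n)
    (F : 'I_n -> R) (c e : R) : 0 < e ->
  (forall h : 'rV[R]_n, `|h| < e ->
     `|f (q + h) - f q - \sum_i h 0 i * F i| <= c * `|h| ^+ 2) ->
  differentiable f q /\ forall v, 'D_v f q = \sum_i v 0 i * F i.
Proof.
move=> e0 H; pose G (h : 'rV[R]_n) := \sum_i h 0 i * F i.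
have Glin : linear G.
  move=> a u v; rewrite /G scaler_sumr -big_split; apply: eq_bigr => i _.
  by rewrite !mxE mulrDl scalerAl.
pose GM := GRing.isLinear.Build _ _ _ _ _ Glin.
pose GL : {linear 'rV[R]_n -> R} := HB.pack G GM.
have cG : continuous GL.
  move=> x; apply: differentiable_continuous.
  rewrite (_ : (GL : _ -> _) = \sum_(i < n) (fun h : 'rV[R]_n => h 0 i * F i)); last first.
    by apply/funext => h; rewrite fct_sumE.
  apply: differentiable_sum => i; apply: differentiableM; last exact: differentiable_cst.
  exact: differentiable_coord.
have approx (a : R) : 0 < a -> \forall h \near (0 : 'rV[R]_n),
    `|(f \o shift q - (cst (f q) + G)) h| <= a * `|h|.
  move=> a0.
  have c10 : 0 < `|c| + 1 by rewrite ltr_pwDr.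
  have m0 : 0 < Num.min e (a / (`|c| + 1)) by rewrite lt_min e0 divr_gt0.
  apply/nbhs_ballP; exists (Num.min e (a / (`|c| + 1))) => // h.
  rewrite -ball_normE /ball_/= sub0r normrN lt_min => /andP[he ha].
  rewrite !fctE /= opprD addrA [h + q]addrC; apply: le_trans (H _ he) _.
  rewrite expr2 mulrA ler_wpM2r//; rewrite ltr_pdivlMr// in ha.
  apply: le_trans (ltW ha); rewrite [leRHS]mulrC ler_wpM2r//.
  by apply: le_trans (ler_norm _) _; rewrite lerDl.
have dE : 'd f q = GL :> (_ -> _) by apply: diff_unique => //; apply/eqaddoP; exact: approx.
have df : differentiable f q.
  by apply/diff_locallyP; rewrite dE; split => //; apply/eqaddoP; exact: approx.
by split => // v; rewrite deriveE// dE.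
Qed.

(** Against the factor [(1 / 4) ^+ k.+1] of the second-order remainders, this leaves the summable
    [2 * (1 / 2) ^+ k.+1]. *)
Lemma mulSn_le_expn k : (k.+1 * k <= 2 ^ k.+2)%N.
Proof.
elim: k => // k IH; have -> : (k.+2 * k.+1 = k.+1 * k + 2 * k.+1)%N by ring.
have le2 : (2 * k.+1 <= 2 * 2 ^ k.+1)%N by rewrite leq_mul2l/= ltnW// ltn_expl.
by apply: leq_trans (leq_add IH le2) _; rewrite -expnS addnn -mul2n -expnS.
Qed.

(** The degree [k] part [D i k] of a partial derivative comes from degree [k + 1] of [f], and its
    bound [(k + 1) B / r ^+ k.+1] fits the radius [r / 2] because [k + 1 <= 2 ^ k]. That the sum
    [F i] of these parts is the derivative follows by summing the second-order remainders of all the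
    [P k]. *)
Lemma hseries_derivative n (f : 'rV[R]_n -> R) p P B r : hseries f p P B r ->
  exists (D : 'I_n -> nat -> 'rV[R]_n -> R) (F : 'I_n -> 'rV[R]_n -> R),
  [/\ forall i, hseries (F i) p (D i) (B / r) (r / 2),
      forall v, P 1%N v = \sum_i v 0 i * D i 0%N 0
    & forall q : 'rV[R]_n, (forall i, `|q 0 i - p 0 i| < r / 8) ->
        differentiable f q /\ forall v, 'D_v f q = \sum_i v 0 i * F i q].
Proof.
move=> [r0 B0 HP cP].
have /choice[D0 HD] : forall k, exists D : 'I_n -> 'rV[R]_n -> R,
    (forall i, hpoly k (k.+1%:R * (B / r ^+ k.+1)) (D i)) /\
    forall s t (x h : 'rV[R]_n), 0 <= t -> 0 <= s ->
      (forall i, `|x 0 i| <= t) -> (forall i, `|(x + h) 0 i| <= t) ->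
      (forall i, `|h 0 i| <= s) ->
    `|P k.+1 (x + h) - P k.+1 x - \sum_i h 0 i * D i x| * t ^+ 2
       <= (k.+1 * k)%:R * (B / r ^+ k.+1) * t ^+ k.+1 * s ^+ 2.
  by move=> k; have [D D1 D2] := hpoly_derivative (HP k.+1); exists D.
pose D i k := D0 k i.
pose F i x := limn (series (fun k => D i k (x - p))).
have Br0 : 0 <= B / r by rewrite divr_ge0// ltW.
have r20 : 0 < r / 2 by rewrite divr_gt0.
have hD i k : hpoly k (B / r / (r / 2) ^+ k) (D i k).
  apply: hpolyW ((HD k).1 i).
  rewrite expr_div_n invf_div exprS invfM !mulrA [leRHS]mulrAC [leRHS]mulrC mulrA.
  rewrite -!mulrA ler_wpM2r//; first by rewrite !mulr_ge0 ?invr_ge0 ?exprn_ge0// ltW.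
  by rewrite -natrX ler_nat ltn_expl.
have hF i : hseries (F i) p (D i) (B / r) (r / 2).
  split=> // x xp.
  (* The largest deviation is strictly below [r / 2], so [t / (r / 2)] is the ratio of a convergent
     geometric series. *)
  pose t := \big[Num.max/0]_i `|x 0 i - p 0 i|.
  have t0 : 0 <= t by rewrite /t; elim/big_ind : _ => // a b a0 b0; rewrite le_max a0.
  have tr : t < r / 2 by apply: bigmax_lt.
  have xt j : `|(x - p) 0 j| <= t by rewrite !mxE; exact: le_bigmax.
  have : cvgn [normed series (fun k => D i k (x - p))].
    apply: (@series_le_cvg _ _ (geometric (B / r) (t / (r / 2)))) => [k|k|k|].
    - exact: normr_ge0.
    - by rewrite /= mulr_ge0// exprn_ge0// divr_ge0// ltW.
    - by rewrite /= expr_div_n mulrCA mulrC; apply: hpoly_le.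
    - apply: is_cvg_geometric_series; rewrite ger0_norm ?divr_ge0// ?ltr_pdivrMr ?mul1r//.
      exact: ltW.
  exact: normed_cvg.
exists D, F; split => //.
  (* At [k = 0] the remainder bound carries the factor [1 * 0], so [P 1%N] equals its linear
     expansion at the origin; [1 + |v|] is a positive bound that can be cancelled. *)
  move=> v; have [_ /(_ `|v| (1 + `|v|) 0 v)] := HD 0%N.
  have [Q [m [_ _ P1E]]] := HP 1%N.
  have -> : P 1%N 0 = 0 by rewrite P1E big1// => i _; rewrite mxE mul0r.
  rewrite muln0 !mul0r add0r subr0 => /(_ _ _ _ _ _)H.
  have {H} : `|P 1%N v - \sum_i v 0 i * D0 0%N i 0| * (1 + `|v|) ^+ 2 <= 0.
    apply: H => [||i|i|i]; rewrite ?addr_ge0//.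
    - by rewrite mxE normr0 addr_ge0.
    - by apply: le_trans (coord_le_norm _ _ _) _; rewrite lerDr.
    - exact: coord_le_norm.
  rewrite pmulr_lle0; last by rewrite exprn_gt0// ltr_pwDl.
  by rewrite normr_le0 subr_eq0 => /eqP.
move=> q qp.
have r80 : 0 < r / 8 by rewrite divr_gt0.
(* Both [q - p] and [h] are below [r / 8], so [q - p] and [q - p + h] stay within [t], and
   [t / r = 1 / 4] beats the factor [(k + 1) k]. *)
pose t := r / 4.
have t0 : 0 < t by rewrite divr_gt0.
apply: (@differentiable_quadratic _ _ _ _ (2 * B / t ^+ 2) (r / 8)) => // h hr.
have qt i : `|(q - p) 0 i| < r / 8 by rewrite !mxE; exact: qp.
have ht i : `|h 0 i| < r / 8 by apply: le_lt_trans hr; exact: coord_le_norm.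
have qht i : `|(q - p + h) 0 i| <= t.
  rewrite mxE (le_trans (ler_normD _ _))// /t.
  by have := qt i; have := ht i; lra.
have qht' i : `|(q + h) 0 i - p 0 i| < r.
  have -> : (q + h) 0 i - p 0 i = (q - p + h) 0 i by rewrite !mxE; ring.
  by apply: le_lt_trans (qht i) _; rewrite /t; lra.
have S1 := cP _ qht'.
have S2 : series (fun k => P k (q - p)) @ \oo --> f q.
  by apply: cP => i; apply: lt_trans (qp i) _; lra.
have S3 : (fun N => \sum_i h 0 i * series (fun k => D i k (q - p)) N) @ \oo -->
   \sum_i h 0 i * F i q.
  apply: (@cvg_big _ _ +%R 0 xpredT add_continuous) => i _; apply: cvgMl_tmp.
  have [_ _ _] := hF i; apply => j.
  by apply: lt_trans (qp j) _; lra.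
have hqp : q + h - p = q - p + h by rewrite addrAC.
rewrite hqp in S1.
(* Degree [k + 1] of [f] matches degree [k] of its derivatives, so the partial sums of [f] run one
   term longer; the constant term cancels in the difference. *)
have S1' := S1; rewrite -cvg_shiftS in S1'; have S2' := S2; rewrite -cvg_shiftS in S2'.
have S0 : (fun N => series (fun k => P k (q - p + h)) N.+1 - series (fun k => P k (q - p)) N.+1
    - \sum_i h 0 i * series (fun k => D i k (q - p)) N) @ \oo -->
    f (q + h) - f q - \sum_i h 0 i * F i q by apply: cvgB => //; exact: cvgB.
have S : (fun N => `|series (fun k => P k (q - p + h)) N.+1 - series (fun k => P k (q - p)) N.+1
    - \sum_i h 0 i * series (fun k => D i k (q - p)) N|) @ \oo -->
    `|f (q + h) - f q - \sum_i h 0 i * F i q| by exact: cvg_norm S0.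
rewrite -(cvg_lim _ S)//; apply: limr_le; first exact: cvgP S.
apply: nearW => N.
have [c _ P0] := HP 0%N.
rewrite !seriesEnat /= !big_nat_recl// P0.
rewrite opprD addrACA subrr add0r -sumrB.
have -> : \sum_i h 0 i * series ((D i)^~ (q - p)) N =
    \sum_(0 <= k < N) \sum_i h 0 i * D i k (q - p).
  by rewrite exchange_big; apply: eq_bigr => i _; rewrite seriesEnat mulr_sumr.
rewrite -sumrB; apply: le_trans (ler_norm_sum _ _ _) _.
apply: (@le_trans _ _ (\sum_(0 <= k < N) 2 * B / t ^+ 2 * `|h| ^+ 2 * (1 / 2) ^+ k.+1)).
  apply: ler_sum => k _; have [_ /(_ `|h| t (q - p) h)] := HD k.
  move=> /(_ (ltW t0) (normr_ge0 _)) rem.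
  have {}rem := rem _ qht (fun i => coord_le_norm h 0 i).
  have t20 : 0 < t ^+ 2 by rewrite exprn_gt0.
  rewrite -(ler_pM2r t20); apply: le_trans (rem _) _.
    by move=> i; have := qt i; rewrite /t; lra.
  have -> : 2 * B / t ^+ 2 * `|h| ^+ 2 * (1 / 2) ^+ k.+1 * t ^+ 2
     = 2 * (1 / 2) ^+ k.+1 * B * `|h| ^+ 2.
    by field; exact: lt0r_neq0.
  rewrite ler_wpM2r ?exprn_ge0//.
  have -> : (k.+1 * k)%:R * (B / r ^+ k.+1) * t ^+ k.+1 =
     (k.+1 * k)%:R * (1 / 4) ^+ k.+1 * B.
    rewrite /t !expr_div_n expr1n; field.
    by rewrite !expf_neq0 ?lt0r_neq0.
  rewrite ler_wpM2r//.
  have -> : (1 / 4 : R) ^+ k.+1 = (1 / 2) ^+ k.+1 * (1 / 2) ^+ k.+1.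
    by rewrite -exprMn; congr (_ ^+ _); field.
  rewrite mulrA ler_wpM2r ?exprn_ge0 ?divr_ge0//.
  rewrite expr_div_n expr1n div1r ler_pdivrMr ?exprn_gt0// -natrX -natrM ler_nat -expnS.
  exact: mulSn_le_expn.
rewrite -mulr_sumr ler_piMr//.
  by rewrite !mulr_ge0// ?invr_ge0 ?exprn_ge0// ltW.
have -> : \sum_(0 <= k < N) (1 / 2 : R) ^+ k.+1 = 1 - (1 / 2) ^+ N.
  elim: N => [|N IH]; first by rewrite big_nil expr0 subrr.
  by rewrite big_nat_recr//= IH exprS; lra.
by rewrite lerBlDr lerDl exprn_ge0// divr_ge0.
Qed.

(** A partial derivative is again the sum of such a series, on half the radius; the radius may
    shrink at each order because only finitely many orders are treated at a time. *)
Lemma hseries_smooth n (f : 'rV[R]_n -> R) p P B r : hseries f p P B r -> smooth f p.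
Proof.
move=> + k; elim: k f P B r => // k IH f P B r Hf; have [r0 _ _ _] := Hf.
have [D [F [HF _ df]]] := hseries_derivative Hf.
have r80 : 0 < r / 8 by rewrite divr_gt0.
split.
  by apply: nearS (near_coord p r80) => q /df[].
move=> i; apply: (near_eq_Ck _ (IH _ _ _ _ (HF i))).
apply: nearS (near_coord p r80) => q /df[_ ->].
rewrite (bigD1 i)//= !mxE !eqxx mul1r big1 ?addr0// => j ji.
by rewrite !mxE (negbTE ji) andbF mul0r.
Qed.

Lemma hseries_derive n (f : 'rV[R]_n -> R) p P B r v : hseries f p P B r ->
  'D_v f p = P 1%N v.
Proof.
move=> Hf; have [r0 _ _ _] := Hf.
have [D [F [HF -> df]]] := hseries_derivative Hf.
have [_ ->] : differentiable f p /\ forall v, 'D_v f p = \sum_i v 0 i * F i p.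
  by apply: df => i; rewrite subrr normr0 divr_gt0.
apply: eq_bigr => i _; congr (_ * _).
have [r20 _ HD cF] := HF i.
have S : series (fun k => D i k 0) @ \oo --> F i p.
  have := cF p; rewrite subrr; apply => j; rewrite subrr normr0//.
suff S' : series (fun k => D i k 0) @ \oo --> D i 0%N 0 by exact: cvg_unique S S'.
rewrite -cvg_shiftS.
rewrite (_ : [sequence _]_n = fun=> D i 0%N 0); first exact: cvg_cst.
apply/funext => N; rewrite seriesEnat /= big_nat_recl// big1 ?addr0// => k _.
(* At the centre [t = 0] is allowed, and the bound on a part of positive degree is then [0]. *)
apply/eqP; rewrite -normr_le0; apply: le_trans (hpoly_le (lexx 0) (HD k.+1) _) _.
  by move=> j; rewrite mxE normr0.
by rewrite expr0n mulr0.
Qed.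

End TermwiseDifferentiation.

(** * Complex-valued functions and complex vectors acting on them *)

Section ComplexValued.
Context {R : realType}.
Local Notation C := R[i].

Definition cdiff N (F : 'rV[R]_N -> C) p :=
  differentiable (fun x => complex.Re (F x)) p /\
  differentiable (fun x => complex.Im (F x)) p.

Definition csmooth N (F : 'rV[R]_N -> C) p :=
  smooth (fun x => complex.Re (F x)) p /\ smooth (fun x => complex.Im (F x)) p.

Lemma ReD (a b : C) : complex.Re (a + b) = complex.Re a + complex.Re b.
Proof. by case: a b => ? ? []. Qed.
Lemma ImD (a b : C) : complex.Im (a + b) = complex.Im a + complex.Im b.
Proof. by case: a b => ? ? []. Qed.
Lemma ReM (a b : C) :
  complex.Re (a * b) = complex.Re a * complex.Re b - complex.Im a * complex.Im b.
Proof. by case: a b => ? ? []. Qed.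
Lemma ImM (a b : C) :
  complex.Im (a * b) = complex.Re a * complex.Im b + complex.Im a * complex.Re b.
Proof. by case: a b => ? ? []. Qed.
Lemma complex_eq (a b : C) :
  complex.Re a = complex.Re b -> complex.Im a = complex.Im b -> a = b.
Proof. by case: a b => ? ? [? ?] /= -> ->. Qed.

Lemma csmooth_cdiff N (F : 'rV[R]_N -> C) p : csmooth F p ->
  \forall q \near p, cdiff F q.
Proof.
by case=> /smooth_differentiable dr /smooth_differentiable; exact: nearS2 dr.
Qed.

Lemma csmooth_cst N (c : C) (p : 'rV[R]_N) : csmooth (fun=> c) p.
Proof. by split=> k; exact: Ck_cst. Qed.

Lemma csmoothD N (F G : 'rV[R]_N -> C) p :
  csmooth F p -> csmooth G p -> csmooth (fun x => F x + G x) p.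
Proof.
move=> [Fr Fi] [Gr Gi]; split=> k.
  apply: near_eq_Ck (CkD (Fr k) (Gr k)); apply: nearT => x.
  by rewrite ReD.
by apply: near_eq_Ck (CkD (Fi k) (Gi k)); apply: nearT => x; rewrite ImD.
Qed.

Lemma csmoothM N (F G : 'rV[R]_N -> C) p :
  csmooth F p -> csmooth G p -> csmooth (fun x => F x * G x) p.
Proof.
move=> [Fr Fi] [Gr Gi]; split=> k.
  apply: near_eq_Ck (CkD (CkM (Fr k) (Gr k)) (CkN (CkM (Fi k) (Gi k)))).
  by apply: nearT => x; rewrite ReM.
apply: near_eq_Ck (CkD (CkM (Fr k) (Gi k)) (CkM (Fi k) (Gr k))).
by apply: nearT => x; rewrite ImM.
Qed.

Lemma csmooth_conj N (F : 'rV[R]_N -> C) p :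
  csmooth F p -> csmooth (fun x => conjc (F x)) p.
Proof.
move=> [Fr Fi]; split=> k.
  by apply: near_eq_Ck (Fr k); apply: nearT => x; case: (F x).
by apply: near_eq_Ck (CkN (Fi k)); apply: nearT => x; case: (F x).
Qed.

Lemma csmooth_real N (f : 'rV[R]_N -> R) p :
  smooth f p -> csmooth (fun x => (f x)%:C%C) p.
Proof. by move=> sf; split => // k; exact: Ck_cst. Qed.

Lemma csmoothV N (F : 'rV[R]_N -> C) p : F p != 0 ->
  csmooth F p -> csmooth (fun x => (F x)^-1) p.
Proof.
move=> F0 [Fr Fi].
pose n2 x := complex.Re (F x) * complex.Re (F x) + complex.Im (F x) * complex.Im (F x).
have sn : smooth n2 p by move=> k; apply: CkD; apply: CkM.
have n0 : n2 p != 0.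
  move: F0; rewrite /n2; case: (F p) => a b; apply: contraNN => /=.
  rewrite -!expr2 paddr_eq0 ?sqr_ge0// !sqrf_eq0 eq_complex /=.
  by move=> /andP[-> ->].
have sV : smooth (fun x => (n2 x)^-1) p by move=> k; exact: CkV.
split=> k.
  apply: near_eq_Ck (CkM (Fr k) (sV k)); apply: nearT => x.
  by rewrite /n2; case: (F x) => a b /=; rewrite -!expr2.
apply: near_eq_Ck (CkM (CkN (Fi k)) (sV k)); apply: nearT => x.
by rewrite /n2; case: (F x) => a b /=; rewrite -!expr2 mulNr.
Qed.

Lemma csmooth_comp N N' (F : 'rV[R]_N' -> C) (h : 'rV[R]_N -> 'rV[R]_N') p :
  (forall j, smooth (fun x => h x 0 j) p) -> csmooth F (h p) -> csmooth (F \o h) p.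
Proof.
by move=> sh [Fr Fi]; split=> k;
   [apply: (Ck_comp (fun j => sh j k) (Fr k))|apply: (Ck_comp (fun j => sh j k) (Fi k))].
Qed.

Lemma csmooth_dirderiv N (F : 'rV[R]_N -> C) p v :
  csmooth F p -> csmooth (fun q => dirderiv F q v) p.
Proof. by move=> [Fr Fi]; split; exact: smooth_derive. Qed.

Lemma csmooth_neq0 N (F : 'rV[R]_N -> C) p : csmooth F p -> F p != 0 ->
  \forall q \near p, F q != 0.
Proof.
move=> sF F0; have /nbhs_singleton[dr di] := csmooth_cdiff sF.
have n0 : complex.Re (F p) != 0 \/ complex.Im (F p) != 0.
  by move: F0; case: (F p) => a b; rewrite eq_complex negb_and /= => /orP.
have open0 : forall y : R, y != 0 -> \forall z \near y, z != 0.
  by move=> y y0; exact: open_nbhs_nbhs.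
case: n0 => n0.
  have := differentiable_continuous dr (open0 _ n0).
  by apply: nearS => q /=; apply: contraNN => /eqP ->.
have := differentiable_continuous di (open0 _ n0).
by apply: nearS => q /=; apply: contraNN => /eqP ->.
Qed.

Lemma dirderivD N (F G : 'rV[R]_N -> C) p v : cdiff F p -> cdiff G p ->
  dirderiv (fun x => F x + G x) p v = dirderiv F p v + dirderiv G p v.
Proof.
move=> [Fr Fi] [Gr Gi]; apply: complex_eq; rewrite /= ?ReD ?ImD /=.
  rewrite -(deriveD (diff_derivable Fr) (diff_derivable Gr)).
  by congr ('D_v _ p); apply/funext => x; rewrite ReD.
rewrite -(deriveD (diff_derivable Fi) (diff_derivable Gi)).
by congr ('D_v _ p); apply/funext => x; rewrite ImD.
Qed.

Lemma dirderivM N (F G : 'rV[R]_N -> C) p v : cdiff F p -> cdiff G p ->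
  dirderiv (fun x => F x * G x) p v = F p * dirderiv G p v + dirderiv F p v * G p.
Proof.
move=> [Fr Fi] [Gr Gi].
have dM (f g : 'rV[R]_N -> R) : differentiable f p -> differentiable g p ->
   'D_v (fun x => f x * g x) p = f p * 'D_v g p + g p * 'D_v f p.
  by move=> df dg; rewrite (deriveM (diff_derivable df) (diff_derivable dg)).
apply: complex_eq; rewrite /= !(ReD, ImD, ReM, ImM) /=.
  have -> : (fun x => complex.Re (F x * G x)) =
      (fun x => complex.Re (F x) * complex.Re (G x)) -
      (fun x => complex.Im (F x) * complex.Im (G x)).
    by apply/funext => x; rewrite ReM.
  rewrite deriveB; [|apply: diff_derivable; exact: differentiableM..].
  by rewrite !dM//; ring.
have -> : (fun x => complex.Im (F x * G x)) =
    (fun x => complex.Re (F x) * complex.Im (G x)) +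
    (fun x => complex.Im (F x) * complex.Re (G x)).
  by apply/funext => x; rewrite ImM.
rewrite deriveD; [|apply: diff_derivable; exact: differentiableM..].
by rewrite !dM//; ring.
Qed.

Lemma dirderiv_conj N (F : 'rV[R]_N -> C) p v : cdiff F p ->
  dirderiv (fun x => conjc (F x)) p v = conjc (dirderiv F p v).
Proof.
move=> [Fr Fi]; apply: complex_eq => /=.
  by congr ('D_v _ p); apply/funext => x; case: (F x).
rewrite -(deriveN (diff_derivable Fi)).
by congr ('D_v _ p); apply/funext => x; rewrite fctE; case: (F x).
Qed.

Lemma dirderiv_cst N (c : C) (p v : 'rV[R]_N) : dirderiv (fun=> c) p v = 0.
Proof. by apply: complex_eq; rewrite /= derive_cst. Qed.

Lemma dirderiv_real N (f : 'rV[R]_N -> R) p v :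
  dirderiv (fun x => (f x)%:C%C) p v = ('D_v f p)%:C%C.
Proof. by apply: complex_eq => //=; rewrite derive_cst. Qed.

Lemma dirderiv_symmetric N (F : 'rV[R]_N -> C) p u v : csmooth F p ->
  dirderiv (fun q => dirderiv F q u) p v = dirderiv (fun q => dirderiv F q v) p u.
Proof.
by move=> [Fr Fi]; apply: complex_eq => /=; exact: smooth_derive_symmetric.
Qed.

Lemma dirderiv_coord N (F : 'rV[R]_N -> C) p (v : 'rV[R]_N) : cdiff F p ->
  dirderiv F p v = \sum_k (v 0 k)%:C%C * dirderiv F p (delta_mx 0 k).
Proof.
move=> [Fr Fi]; rewrite /dirderiv (derive_sum_coord v Fr) (derive_sum_coord v Fi).
by apply: complex_eq; rewrite raddf_sum /=; apply: eq_bigr => k _ /=;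
  rewrite mul0r ?subr0 ?addr0.
Qed.

Lemma dirderiv_comp N N' (F : 'rV[R]_N' -> C) (h : 'rV[R]_N -> 'rV[R]_N') p v :
  (forall j, differentiable (fun x => h x 0 j) p) -> cdiff F (h p) ->
  dirderiv (F \o h) p v =
  \sum_j ('D_v (fun x => h x 0 j) p)%:C%C * dirderiv F (h p) (delta_mx 0 j).
Proof.
move=> dhj dF; have dh := differentiable_rV dhj; have [Fr Fi] := dF.
have -> : dirderiv (F \o h) p v = dirderiv F (h p) ('D_v h p).
  by apply: complex_eq; rewrite /= -derive_comp.
rewrite dirderiv_coord//; apply: eq_bigr => j _.
by rewrite derive_rV.
Qed.

Lemma apply_vectD N (X : 'rV[C]_N) F G p : cdiff F p -> cdiff G p ->
  apply_vect X (fun x => F x + G x) p = apply_vect X F p + apply_vect X G p.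
Proof.
move=> dF dG; rewrite /apply_vect -big_split; apply: eq_bigr => k _.
by rewrite dirderivD// mulrDr.
Qed.

Lemma apply_vectM N (X : 'rV[C]_N) F G p : cdiff F p -> cdiff G p ->
  apply_vect X (fun x => F x * G x) p = F p * apply_vect X G p + apply_vect X F p * G p.
Proof.
move=> dF dG; rewrite /apply_vect mulr_sumr mulr_suml -big_split; apply: eq_bigr => k _.
by rewrite dirderivM//=; ring.
Qed.

Lemma apply_vect_conj N (X : 'rV[C]_N) F p : cdiff F p ->
  apply_vect (map_mx conjc X) (fun x => conjc (F x)) p = conjc (apply_vect X F p).
Proof.
move=> dF; rewrite /apply_vect rmorph_sum; apply: eq_bigr => k _.
by rewrite mxE dirderiv_conj// rmorphM.
Qed.

Lemma apply_vect_linear N (a : C) (X Y : 'rV[C]_N) F p :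
  apply_vect (a *: X + Y) F p = a * apply_vect X F p + apply_vect Y F p.
Proof.
rewrite /apply_vect mulr_sumr -big_split; apply: eq_bigr => k _.
by rewrite !mxE mulrDl mulrA.
Qed.

Lemma apply_vect_cst N (X : 'rV[C]_N) (c : C) p : apply_vect X (fun=> c) p = 0.
Proof. by rewrite /apply_vect big1// => k _; rewrite dirderiv_cst mulr0. Qed.

End ComplexValued.

(** * Derivatives and brackets along a subset *)

Section TangentialCalculus.
Context {R : realType} {N : nat}.
Local Notation C := R[i].
Implicit Types (M V : set 'rV[R]_N) (p q : 'rV[R]_N) (f g : 'rV[R]_N -> C) (X Y Z : vfield R N).

(** A weakening of [analytic_along] whose stability under products, inverses, composition and
    derivatives requires no power series. *)
Definition smooth_along M f p :=
  exists2 F, csmooth F p & \forall q \near p, M q -> F q = f q.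

Lemma smooth_along_ext M f p F : csmooth F p -> (\forall q \near p, M q -> F q = f q) ->
  local_extension M f p F.
Proof. by move=> /csmooth_cdiff/nbhs_singleton[]. Qed.

Lemma smooth_along_eq M f g p : (\forall q \near p, M q -> f q = g q) ->
  smooth_along M f p -> smooth_along M g p.
Proof.
move=> fg [F sF Ff]; exists F => //.
by apply: nearS2 fg Ff => q fg Ff Mq; rewrite Ff// fg.
Qed.

Lemma smooth_along_cst M c p : smooth_along M (fun=> c) p.
Proof. by exists (fun=> c); [exact: csmooth_cst|exact: nearT]. Qed.

Lemma smooth_alongD M f g p : smooth_along M f p -> smooth_along M g p ->
  smooth_along M (fun x => f x + g x) p.
Proof.
move=> [F sF Ff] [G sG Gg]; exists (fun x => F x + G x); first exact: csmoothD.
by apply: nearS2 Ff Gg => q Ff Gg Mq; rewrite Ff// Gg.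
Qed.

Lemma smooth_alongM M f g p : smooth_along M f p -> smooth_along M g p ->
  smooth_along M (fun x => f x * g x) p.
Proof.
move=> [F sF Ff] [G sG Gg]; exists (fun x => F x * G x); first exact: csmoothM.
by apply: nearS2 Ff Gg => q Ff Gg Mq; rewrite Ff// Gg.
Qed.

Lemma smooth_along_conj M f p : smooth_along M f p ->
  smooth_along M (fun x => conjc (f x)) p.
Proof.
move=> [F sF Ff]; exists (fun x => conjc (F x)); first exact: csmooth_conj.
by apply: nearS Ff => q Ff Mq; rewrite Ff.
Qed.

Lemma smooth_alongV M f p : M p -> f p != 0 -> smooth_along M f p ->
  smooth_along M (fun x => (f x)^-1) p.
Proof.
move=> Mp f0 [F sF Ff]; exists (fun x => (F x)^-1).
  by apply: csmoothV => //; rewrite (nbhs_singleton Ff).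
by apply: nearS Ff => q Ff Mq; rewrite Ff.
Qed.

Lemma smooth_along_neq0 M f p : M p -> f p != 0 -> smooth_along M f p ->
  \forall q \near p, M q -> f q != 0.
Proof.
move=> Mp f0 [F sF Ff]; have Fp0 : F p != 0 by rewrite (nbhs_singleton Ff).
by apply: nearS2 Ff (csmooth_neq0 sF Fp0) => q Ff Fq Mq; rewrite -Ff.
Qed.

Lemma smooth_along_sum M (I : Type) (r : seq I) (f : I -> 'rV[R]_N -> C) p :
  (forall i, smooth_along M (f i) p) -> smooth_along M (fun x => \sum_(i <- r) f i x) p.
Proof.
move=> sf; elim: r => [|i r IH].
  apply: smooth_along_eq (smooth_along_cst M 0 p).
  by apply: nearT => q _; rewrite big_nil.
apply: smooth_along_eq (smooth_alongD (sf i) IH).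
by apply: nearT => q _; rewrite big_cons.
Qed.

(** Run the curve backwards. This is what makes the conjugate [v - i w] of a complex tangent vector
    [v + i w] tangent, without adding tangent vectors. *)
Lemma tangentN M p v : tangent M p v -> tangent M p (- v).
Proof.
move=> [gamma [g0 gM dg]]; exists (fun t => gamma (- t)); split.
- by rewrite oppr0.
- have cN : (fun t : R => - t) @ (0 : R) --> (0 : R).
    have d0 : differentiable (fun t : R => - t) 0 by [].
    have c0 : (fun t : R => - t) @ (0 : R) --> - (0 : R) := differentiable_continuous d0.
    by rewrite oppr0 in c0.
  exact: cN _ gM.
- have d1 : differentiable (fun t : R => - t) 0 by [].
  have d2 : differentiable gamma (- 0 : R).
    by rewrite oppr0; apply/derivable1_diffP; case: dg.
  apply: DeriveDef.
    by apply/derivable1_diffP; exact: (differentiable_comp d1 d2).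
  rewrite (derive_comp (f := gamma) _ d1 d2) oppr0.
  rewrite deriveE; last by rewrite -[X in differentiable _ X]oppr0.
  rewrite (_ : 'D_1 (fun t : R => - t) 0 = - 1); last first.
    by rewrite (@deriveN _ _ _ id)// derive_id.
  rewrite linearN /= -deriveE; last by rewrite -[X in differentiable _ X]oppr0.
  by case: dg => _ ->.
Qed.

Lemma complex_tangent_conj M p (X : 'rV[C]_N) : complex_tangent M p X ->
  complex_tangent M p (map_mx conjc X).
Proof.
move=> [v [w [tv tw ->]]]; exists v, (- w); split => //; first exact: tangentN.
apply/rowP => k; rewrite !mxE rmorphD rmorphM /=; apply: complex_eq => /=; ring.
Qed.

Lemma tangential_deriv_ext M (X : 'rV[C]_N) f F p : complex_tangent M p X ->
  csmooth F p -> (\forall q \near p, M q -> F q = f q) ->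
  tangential_deriv M X f p = apply_vect X F p.
Proof. by move=> tX sF Ff; exact: tangential_derivE tX (smooth_along_ext sF Ff). Qed.

Section AtPoint.
Variables (M : set 'rV[R]_N) (p : 'rV[R]_N) (X : 'rV[C]_N).
Hypotheses (Mp : M p) (tX : complex_tangent M p X).

Lemma tangential_deriv_eq f g : smooth_along M f p ->
  (\forall q \near p, M q -> f q = g q) ->
  tangential_deriv M X f p = tangential_deriv M X g p.
Proof.
move=> [F sF Ff] fg; rewrite (tangential_deriv_ext tX sF Ff).
rewrite (tangential_deriv_ext tX sF)//.
by apply: nearS2 fg Ff => q fg Ff Mq; rewrite Ff// fg.
Qed.

Lemma tangential_derivD f g : smooth_along M f p -> smooth_along M g p ->
  tangential_deriv M X (fun x => f x + g x) p
  = tangential_deriv M X f p + tangential_deriv M X g p.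
Proof.
move=> [F sF Ff] [G sG Gg].
rewrite (tangential_deriv_ext tX sF Ff) (tangential_deriv_ext tX sG Gg).
rewrite (tangential_deriv_ext tX (csmoothD sF sG)).
  by apply: apply_vectD; exact: nbhs_singleton (csmooth_cdiff _).
by apply: nearS2 Ff Gg => q Ff Gg Mq; rewrite Ff// Gg.
Qed.

Lemma tangential_derivM f g : smooth_along M f p -> smooth_along M g p ->
  tangential_deriv M X (fun x => f x * g x) p
  = f p * tangential_deriv M X g p + tangential_deriv M X f p * g p.
Proof.
move=> [F sF Ff] [G sG Gg].
rewrite (tangential_deriv_ext tX sF Ff) (tangential_deriv_ext tX sG Gg).
rewrite (tangential_deriv_ext tX (csmoothM sF sG)).
  rewrite -(nbhs_singleton Ff)// -(nbhs_singleton Gg)//.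
  by apply: apply_vectM; exact: nbhs_singleton (csmooth_cdiff _).
by apply: nearS2 Ff Gg => q Ff Gg Mq; rewrite Ff// Gg.
Qed.

Lemma tangential_deriv_cst c : tangential_deriv M X (fun=> c) p = 0.
Proof.
by rewrite (tangential_deriv_ext tX (csmooth_cst c p)) ?apply_vect_cst//; exact: nearT.
Qed.

Lemma tangential_deriv_conj f : smooth_along M f p ->
  tangential_deriv M (map_mx conjc X) (fun x => conjc (f x)) p
  = conjc (tangential_deriv M X f p).
Proof.
move=> [F sF Ff]; rewrite (tangential_deriv_ext tX sF Ff).
rewrite (tangential_deriv_ext (complex_tangent_conj tX) (csmooth_conj sF)).
  by apply: apply_vect_conj; exact: nbhs_singleton (csmooth_cdiff _).
by apply: nearS Ff => q Ff Mq; rewrite Ff.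
Qed.

(** Tangency of the combination is a hypothesis because velocities of curves on an arbitrary set
    need not be closed under sums. Once all three vectors are tangent, one extension of [f] computes
    all three derivatives. *)
Lemma tangential_deriv_linear (a : C) (Y : 'rV[C]_N) f : complex_tangent M p Y ->
  complex_tangent M p (a *: X + Y) -> smooth_along M f p ->
  tangential_deriv M (a *: X + Y) f p
  = a * tangential_deriv M X f p + tangential_deriv M Y f p.
Proof.
move=> tY tZ [F sF Ff]; rewrite !(tangential_deriv_ext _ sF Ff)//.
exact: apply_vect_linear.
Qed.

Lemma tangential_derivZ (a : C) f :
  complex_tangent M p (a *: X) -> smooth_along M f p ->
  tangential_deriv M (a *: X) f p = a * tangential_deriv M X f p.
Proof.
move=> tZ [F sF Ff]; rewrite !(tangential_deriv_ext _ sF Ff)//.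
by rewrite /apply_vect mulr_sumr; apply: eq_bigr => k _; rewrite mxE mulrA.
Qed.

End AtPoint.

Section OnOpenPart.
Variables (M V : set 'rV[R]_N).
Hypothesis openV : open V.

Definition smooth_on f := forall q, M q -> V q -> smooth_along M f q.

(** Tangency belongs to the notion: only then do derivatives along the field agree with those of any
    extension. *)
Definition smooth_field X := forall q, M q -> V q ->
  complex_tangent M q (X q) /\ forall k, smooth_along M (fun x => X x 0 k) q.

Lemma near_open p : V p -> \forall q \near p, V q.
Proof. by move=> Vp; exact: open_nbhs_nbhs. Qed.

Lemma eq_on_near f g p : (forall q, M q -> V q -> f q = g q) -> V p ->
  \forall q \near p, M q -> f q = g q.
Proof. by move=> fg /near_open; apply: nearS => q Vq Mq; exact: fg. Qed.

Lemma smooth_field_conj X : smooth_field X -> smooth_field (conj_field X).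
Proof.
move=> sX q Mq Vq; have [tX cX] := sX q Mq Vq; split; first exact: complex_tangent_conj.
move=> k; apply: smooth_along_eq (smooth_along_conj (cX k)).
by apply: nearT => x _; rewrite mxE.
Qed.

(** An extension [F] chosen at [p] extends [f] at all nearby points of [M] as well. Hence near [p]
    the derivative agrees on [M] with the single expression [\sum_k X_k dF/dx_k], even though
    [tangential_deriv] may pick another extension at each point. *)
Lemma smooth_on_tangential_deriv X f : smooth_field X -> smooth_on f ->
  smooth_on (fun q => tangential_deriv M (X q) f q).
Proof.
move=> sX sf p Mp Vp; have [F sF Ff] := sf p Mp Vp; have [_ cX] := sX p Mp Vp.
have : smooth_along M (fun q => \sum_k X q 0 k * dirderiv F q (delta_mx 0 k)) p.
  apply: smooth_along_sum => k; apply: smooth_alongM; first exact: cX.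
  by exists (fun q => dirderiv F q (delta_mx 0 k)); [exact: csmooth_dirderiv|exact: nearT].
apply: smooth_along_eq.
apply: nearS2 (near_open Vp) (near_join (filterI (csmooth_cdiff sF) Ff)) => q Vq nq Mq.
have [tX _] := sX q Mq Vq; apply/esym/tangential_derivE => //.
have [dF Ff'] : (cdiff F q) /\ \forall x \near q, M x -> F x = f x.
  split; first by have [] := nbhs_singleton nq.
  by apply: nearS nq => x [].
by case: dF.
Qed.

Lemma lie_bracketE X Y p k : lie_bracket M X Y p 0 k =
  tangential_deriv M (X p) (fun q => Y q 0 k) p - tangential_deriv M (Y p) (fun q => X q 0 k) p.
Proof. by rewrite /lie_bracket mxE. Qed.

Lemma lie_bracketC X Y p : lie_bracket M X Y p = - lie_bracket M Y X p.
Proof. by apply/rowP => k; rewrite !mxE opprB. Qed.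

Lemma smooth_on_bracket X Y k : smooth_field X -> smooth_field Y ->
  smooth_on (fun q => lie_bracket M X Y q 0 k).
Proof.
move=> sX sY q Mq Vq.
have h1 : smooth_along M (fun q => tangential_deriv M (X q) (fun x => Y x 0 k) q) q.
  by apply: smooth_on_tangential_deriv => // x Mx Vx; case: (sY x Mx Vx).
have h2 : smooth_along M (fun q => tangential_deriv M (Y q) (fun x => X x 0 k) q) q.
  by apply: smooth_on_tangential_deriv => // x Mx Vx; case: (sX x Mx Vx).
apply: smooth_along_eq (smooth_alongD h1 (smooth_alongM (smooth_along_cst M (-1) q) h2)).
by apply: nearT => x _; rewrite mxE mulN1r.
Qed.

Lemma lie_bracket_eq X Y X' Y' p : smooth_field X -> smooth_field Y ->
  (forall q, M q -> V q -> X' q = X q) -> (forall q, M q -> V q -> Y' q = Y q) ->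
  M p -> V p -> lie_bracket M X' Y' p = lie_bracket M X Y p.
Proof.
move=> sX sY XX YY Mp Vp; have [tX cX] := sX p Mp Vp; have [tY cY] := sY p Mp Vp.
apply/rowP => k; rewrite !lie_bracketE (XX _ Mp Vp) (YY _ Mp Vp).
rewrite -(tangential_deriv_eq (g := fun q => Y' q 0 k) tX (cY k)); last first.
  by apply: eq_on_near => // q Mq Vq; rewrite YY.
rewrite -(tangential_deriv_eq (g := fun q => X' q 0 k) tY (cX k))//.
by apply: eq_on_near => // q Mq Vq; rewrite XX.
Qed.

Lemma lie_bracket_conj X Y p : smooth_field X -> smooth_field Y -> M p -> V p ->
  lie_bracket M (conj_field X) (conj_field Y) p = map_mx conjc (lie_bracket M X Y p).
Proof.
move=> sX sY Mp Vp; have [tX cX] := sX p Mp Vp; have [tY cY] := sY p Mp Vp.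
have conjE (Z : vfield R N) k : (fun q => conj_field Z q 0 k) = fun q => conjc (Z q 0 k).
  by apply/funext => x; rewrite mxE.
apply/rowP => k; rewrite [RHS]mxE !lie_bracketE !conjE rmorphB /=.
by rewrite (tangential_deriv_conj tX (cY k)) (tangential_deriv_conj tY (cX k)).
Qed.

Lemma lie_bracketDr X Y Z W p : smooth_field X -> smooth_field Y -> smooth_field Z ->
  smooth_field W -> (forall q, M q -> V q -> W q = Y q + Z q) -> M p -> V p ->
  lie_bracket M X W p = lie_bracket M X Y p + lie_bracket M X Z p.
Proof.
move=> sX sY sZ sW WE Mp Vp.
have [tX cX] := sX p Mp Vp; have [tY cY] := sY p Mp Vp; have [tZ cZ] := sZ p Mp Vp.
have [tW cW] := sW p Mp Vp.
apply/rowP => k; rewrite [RHS]mxE !lie_bracketE.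
have -> : tangential_deriv M (X p) (fun q => W q 0 k) p =
   tangential_deriv M (X p) (fun q => Y q 0 k) p + tangential_deriv M (X p) (fun q => Z q 0 k) p.
  rewrite -(tangential_derivD tX (cY k) (cZ k)); apply: (tangential_deriv_eq tX (cW k)).
  by apply: eq_on_near => // q Mq Vq; rewrite WE// mxE.
have -> : tangential_deriv M (W p) (fun q => X q 0 k) p =
   tangential_deriv M (Y p) (fun q => X q 0 k) p + tangential_deriv M (Z p) (fun q => X q 0 k) p.
  move: tW; rewrite WE// -[Y p]scale1r => tW.
  by rewrite tangential_deriv_linear// mul1r scale1r.
by rewrite opprD addrACA.
Qed.

(** Leibniz rule. The scaled fields are separate variables, since a push-forward is known to be a
    multiple of another field only at the points of [M] in [V]. *)
Lemma lie_bracketZ X Y X' Y' f g p : smooth_field X -> smooth_field Y ->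
  smooth_field X' -> smooth_field Y' -> smooth_on f -> smooth_on g ->
  (forall q, M q -> V q -> X' q = f q *: X q) ->
  (forall q, M q -> V q -> Y' q = g q *: Y q) -> M p -> V p ->
  lie_bracket M X' Y' p = (f p * g p) *: lie_bracket M X Y p
    + (f p * tangential_deriv M (X p) g p) *: Y p
    - (g p * tangential_deriv M (Y p) f p) *: X p.
Proof.
move=> sX sY sX' sY' sf sg XE YE Mp Vp.
have [tX cX] := sX p Mp Vp; have [tY cY] := sY p Mp Vp.
have [tX' cX'] := sX' p Mp Vp; have [tY' cY'] := sY' p Mp Vp.
have {}sf := sf p Mp Vp; have {}sg := sg p Mp Vp.
have half (A A' B B' : vfield R N) a b k : complex_tangent M p (A p) ->
   complex_tangent M p (A' p) -> smooth_along M (fun q => B' q 0 k) p ->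
   smooth_along M (fun q => B q 0 k) p -> smooth_along M b p ->
   A' p = a *: A p -> (forall q, M q -> V q -> B' q = b q *: B q) ->
   tangential_deriv M (A' p) (fun q => B' q 0 k) p =
   a * (b p * tangential_deriv M (A p) (fun q => B q 0 k) p
        + tangential_deriv M (A p) b p * B p 0 k).
  move=> tA tA' cB' cB sb AE BE; rewrite AE in tA' *.
  rewrite tangential_derivZ//; congr (_ * _).
  rewrite -(tangential_derivM Mp tA sb cB); apply: (tangential_deriv_eq tA cB').
  by apply: eq_on_near => // q Mq Vq; rewrite BE// mxE.
apply/rowP => k; rewrite [RHS]mxE [X in X + _]mxE [X in X + _ + _]mxE [X in _ + X + _]mxE.
rewrite [X in _ = _ + X]mxE [X in - X]mxE !lie_bracketE.
rewrite (half X X' Y Y' (f p) g k)//; last exact: XE.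
rewrite (half Y Y' X X' (g p) f k)//; last exact: YE.
by set a := tangential_deriv _ _ _ _; set b := tangential_deriv _ _ _ _;
   set c := tangential_deriv _ _ _ _; set d := tangential_deriv _ _ _ _; ring.
Qed.

End OnOpenPart.

End TangentialCalculus.

(** * Push-forward of vector fields *)

Section PushForward.
Context {R : realType} {N : nat}.
Local Notation C := R[i].
Implicit Types (M U : set 'rV[R]_N) (h g : 'rV[R]_N -> 'rV[R]_N) (X Y : vfield R N).

Lemma tangential_deriv_sum M p (X : 'rV[C]_N) (I : Type) (r : seq I)
    (f : I -> 'rV[R]_N -> C) : complex_tangent M p X ->
  (forall i, smooth_along M (f i) p) ->
  tangential_deriv M X (fun x => \sum_(i <- r) f i x) p
  = \sum_(i <- r) tangential_deriv M X (f i) p.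
Proof.
move=> tX sf; elim: r => [|i r IH].
  have -> : (fun x => \sum_(i <- [::]) f i x) = fun=> 0 by apply/funext => x; rewrite big_nil.
  by rewrite (tangential_deriv_cst tX 0) big_nil.
have -> : (fun x => \sum_(j <- i :: r) f j x) = fun x => f i x + \sum_(j <- r) f j x.
  by apply/funext => x; rewrite big_cons.
by rewrite (tangential_derivD tX (sf i) (smooth_along_sum r sf)) IH big_cons.
Qed.

Lemma apply_vect_near_eq (X : 'rV[C]_N) F G p : (\forall q \near p, F q = G q) ->
  apply_vect X F p = apply_vect X G p.
Proof.
move=> FG; apply: eq_bigr => k _; congr (_ * _); apply: complex_eq => /=;
by apply: near_eq_derive; apply: nearS FG => q ->.
Qed.

Definition dmap h p (X : 'rV[C]_N) : 'rV[C]_N :=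
  \row_k apply_vect X (fun x => (h x 0 k)%:C%C) p.

Lemma dmap_linear h p (a : C) (X Y : 'rV[C]_N) :
  dmap h p (a *: X + Y) = a *: dmap h p X + dmap h p Y.
Proof. by apply/rowP => k; rewrite !mxE apply_vect_linear. Qed.

Lemma dmapZ h p (a : C) (X : 'rV[C]_N) : dmap h p (a *: X) = a *: dmap h p X.
Proof.
apply/rowP => k; rewrite !mxE /apply_vect mulr_sumr; apply: eq_bigr => i _.
by rewrite mxE mulrA.
Qed.

Lemma dmap_real h p (v : 'rV[R]_N) : (forall j, differentiable (fun x => h x 0 j) p) ->
  dmap h p (map_mx (real_complex R) v) = map_mx (real_complex R) ('D_v h p).
Proof.
move=> dh; apply/rowP => k; rewrite !mxE derive_rV; last exact: differentiable_rV.
rewrite (derive_sum_coord v (dh k)) rmorph_sum; apply: eq_bigr => i _.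
by rewrite mxE dirderiv_real rmorphM.
Qed.

Lemma dmap_conj h p (X : 'rV[C]_N) : dmap h p (map_mx conjc X) = map_mx conjc (dmap h p X).
Proof.
apply/rowP => k; rewrite !mxE rmorph_sum; apply: eq_bigr => i _.
by rewrite mxE !dirderiv_real rmorphM/= oppr0.
Qed.

Lemma apply_vect_comp h p (X : 'rV[C]_N) F :
  (forall j, differentiable (fun x => h x 0 j) p) -> cdiff F (h p) ->
  apply_vect X (F \o h) p = apply_vect (dmap h p X) F (h p).
Proof.
move=> dh dF; rewrite /apply_vect.
under eq_bigr do rewrite (dirderiv_comp _ dh dF) mulr_sumr.
rewrite exchange_big; apply: eq_bigr => j _ /=; rewrite mxE mulr_suml.
by apply: eq_bigr => i _; rewrite dirderiv_real mulrA.
Qed.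

Definition smooth_map M U M' U' h :=
  [/\ open U, forall p, U p -> U' (h p), forall p, M p -> U p -> M' (h p)
    & forall p, U p -> forall k, smooth (fun x => h x 0 k) p].

Lemma smooth_map_differentiable M U M' U' h p : smooth_map M U M' U' h -> U p ->
  forall j, differentiable (fun x => h x 0 j) p.
Proof.
by move=> [_ _ _ sh] Up j; exact: nbhs_singleton (smooth_differentiable (sh p Up j)).
Qed.

Lemma smooth_map_continuous M U M' U' h p : smooth_map M U M' U' h -> U p ->
  {for p, continuous h}.
Proof.
move=> sh Up; apply: differentiable_continuous; apply: differentiable_rV.
exact: smooth_map_differentiable sh Up.
Qed.

Lemma tangent_map M U M' U' h p v : smooth_map M U M' U' h -> U p ->
  tangent M p v -> tangent M' (h p) ('D_v h p).
Proof.
move=> sh Up [gamma [g0 gM dg]]; exists (h \o gamma).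
have dh : differentiable h p := differentiable_rV (smooth_map_differentiable sh Up).
have dgam : differentiable gamma 0 by apply/derivable1_diffP; case: dg.
have [oU _ MM' _] := sh; split; first by rewrite /= g0.
  have Ug : \forall t \near (0 : R), U (gamma t).
    have Ug0 : \forall q \near gamma 0, U q by rewrite g0; exact: open_nbhs_nbhs.
    exact: differentiable_continuous dgam _ Ug0.
  by near=> t; apply: MM'; [near: t; exact: gM|near: t; exact: Ug].
have dhg : differentiable h (gamma 0) by rewrite g0.
apply: DeriveDef.
  by apply/derivable1_diffP; exact: (differentiable_comp dgam dhg).
by rewrite (derive_comp _ dgam dhg) g0; case: dg => _ ->.
Unshelve. all: by end_near. Qed.

Lemma complex_tangent_map M U M' U' h p (X : 'rV[C]_N) : smooth_map M U M' U' h -> U p ->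
  complex_tangent M p X -> complex_tangent M' (h p) (dmap h p X).
Proof.
move=> sh Up [v [w [tv tw ->]]]; have dh := smooth_map_differentiable sh Up.
exists ('D_v h p), ('D_w h p); split; [exact: tangent_map sh Up tv|exact: tangent_map sh Up tw|].
by rewrite addrC dmap_linear !dmap_real// addrC.
Qed.

Section Diffeomorphism.
Variables (M M' U U' : set 'rV[R]_N) (h g : 'rV[R]_N -> 'rV[R]_N).
Hypotheses (sh : smooth_map M U M' U' h) (sg : smooth_map M' U' M U g).
Hypotheses (gh : forall p, U p -> g (h p) = p) (hg : forall q, U' q -> h (g q) = q).

(** Chain rule for [g \o h], which is the identity near [p] because [U] is open. *)
Lemma dmapK p (X : 'rV[C]_N) : U p -> dmap g (h p) (dmap h p X) = X.
Proof.
move=> Up; have [oU hU _ _] := sh; apply/rowP => k; rewrite mxE.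
rewrite -(@apply_vect_comp h p X (fun x => (g x 0 k)%:C%C)).
- rewrite (@apply_vect_near_eq _ _ (fun x => (x 0 k)%:C%C)).
    rewrite /apply_vect (bigD1 k)//= dirderiv_real derive_coord mxE !eqxx mulr1.
    rewrite big1 ?addr0// => i ik.
    by rewrite dirderiv_real derive_coord mxE eq_sym (negbTE ik) andbF mulr0.
  by apply: nearS (near_open oU Up) => q Uq /=; rewrite gh.
- exact: smooth_map_differentiable sh Up.
- split; last exact: differentiable_cst.
  exact: (smooth_map_differentiable sg (hU p Up) k).
Qed.

Lemma push_field_smooth X : smooth_field M U X -> smooth_field M' U' (push_field h g X).
Proof.
have [oU' gU gM sgk] := sg; have [_ _ _ shk] := sh.
move=> sX q Mq Uq; have [tX cX] := sX _ (gM _ Mq Uq) (gU _ Uq); split.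
  by have := complex_tangent_map sh (gU _ Uq) tX; rewrite hg.
move=> k; rewrite (_ : (fun _ => _) = fun x => \sum_i X (g x) 0 i *
    dirderiv (fun x => (h x 0 k)%:C%C) (g x) (delta_mx 0 i)); last first.
  by apply/funext => x; rewrite mxE.
apply: smooth_along_sum => i; apply: smooth_alongM.
  have [F sF FX] := cX i; exists (F \o g); first exact: csmooth_comp (sgk q Uq) sF.
  have := smooth_map_continuous sg Uq FX.
  by apply: nearS2 (near_open oU' Uq) => x Ux FXx Mx; apply: FXx; exact: gM.
exists ((fun y => dirderiv (fun x => (h x 0 k)%:C%C) y (delta_mx 0 i)) \o g); last exact: nearT.
apply: csmooth_comp (sgk q Uq) _; apply: csmooth_dirderiv; apply: csmooth_real.
exact: shk (gU q Uq) k.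
Qed.

(** If [F] extends [f] near [h p], then [F \o h] extends [f \o h] near [p]; the chain rule compares
    the two. *)
Lemma tangential_deriv_push p (X : 'rV[C]_N) f : U p -> complex_tangent M p X ->
  smooth_along M' f (h p) ->
  tangential_deriv M' (dmap h p X) f (h p) = tangential_deriv M X (f \o h) p.
Proof.
move=> Up tX [F sF Ff]; have [oU hU hM shk] := sh.
rewrite (tangential_deriv_ext (complex_tangent_map sh Up tX) sF Ff).
rewrite -apply_vect_comp; last 2 first.
- exact: smooth_map_differentiable sh Up.
- exact: nbhs_singleton (csmooth_cdiff sF).
apply/esym/(tangential_deriv_ext tX (csmooth_comp (shk p Up) sF)).
have := smooth_map_continuous sh Up Ff.
by apply: nearS2 (near_open oU Up) => x Ux FXx Mx; apply: FXx; exact: hM.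
Qed.

(** Writing [H j] for the coordinates of [h], the [j]-th coefficient of [h_* Y] pulls back to
    [\sum_i Y_i dH_j/dx_i]. Applying [X] gives the wanted first-order terms and a second-order term,
    and the latter drops out after antisymmetrization. *)
Lemma push_field_bracket X Y q : smooth_field M U X -> smooth_field M U Y ->
  M' q -> U' q ->
  lie_bracket M' (push_field h g X) (push_field h g Y) q
  = push_field h g (lie_bracket M X Y) q.
Proof.
move=> sX sY Mq Uq; have [oU' gU gM sgk] := sg; have [oU hU hM shk] := sh.
set p := g q; have Up : U p := gU q Uq; have Mp : M p := gM q Mq Uq.
have qE : q = h p by rewrite hg.
have [tX cX] := sX p Mp Up; have [tY cY] := sY p Mp Up.
pose H j x := (h x 0 j)%:C%C : C.
have sH j : csmooth (H j) p by apply: csmooth_real; exact: shk.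
pose dH i j x := dirderiv (H j) x (delta_mx 0 i).
have sdH i j : csmooth (dH i j) p by exact: csmooth_dirderiv.
have adH i j : smooth_along M (dH i j) p by exists (dH i j) => //; exact: nearT.
have half Z W j : smooth_field M U Z -> smooth_field M U W ->
    tangential_deriv M' (push_field h g Z q) (fun x => push_field h g W x 0 j) q =
    \sum_i (W p 0 i * \sum_m Z p 0 m * dirderiv (dH i j) p (delta_mx 0 m)
            + tangential_deriv M (Z p) (fun x => W x 0 i) p * dH i j p).
  move=> sZ sW; have [tZ cZ] := sZ p Mp Up; have [tW cW] := sW p Mp Up.
  have [_ /(_ j)cP] := push_field_smooth sW Mq Uq.
  have -> : push_field h g Z q = dmap h p (Z p) by [].
  rewrite qE in cP *; rewrite (tangential_deriv_push Up tZ cP).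
  have sWd i : smooth_along M (fun x => W x 0 i * dH i j x) p by exact: smooth_alongM.
  rewrite -(tangential_deriv_eq (f := fun x => \sum_i W x 0 i * dH i j x) tZ); last 2 first.
  - exact: smooth_along_sum.
  - apply: nearS (near_open oU Up) => x Ux Mx /=.
    by rewrite /push_field mxE gh.
  rewrite tangential_deriv_sum//; apply: eq_bigr => i _.
  rewrite (tangential_derivM Mp tZ (cW i) (adH i j)).
  by rewrite (tangential_deriv_ext tZ (sdH i j))//; exact: nearT.
apply/rowP => j; rewrite lie_bracketE !half// -sumrB /push_field mxE /apply_vect.
rewrite -/p.
under eq_bigr do rewrite opprD addrACA.
rewrite big_split /=.
(* The sums of [X_m Y_i] times the second derivatives of [H j] agree after exchanging [i] and [m],
   by symmetry of those derivatives. *)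
have -> : \sum_i (Y p 0 i * (\sum_m X p 0 m * dirderiv (dH i j) p (delta_mx 0 m)) -
     X p 0 i * (\sum_m Y p 0 m * dirderiv (dH i j) p (delta_mx 0 m))) = 0.
  rewrite sumrB; apply/eqP; rewrite subr_eq0; apply/eqP.
  under eq_bigr do rewrite mulr_sumr.
  under [RHS]eq_bigr do rewrite mulr_sumr.
  rewrite exchange_big; apply: eq_bigr => m _; apply: eq_bigr => i _.
  have E : dirderiv (dH i j) p (delta_mx 0 m) = dirderiv (dH m j) p (delta_mx 0 i).
    exact: dirderiv_symmetric (sH j).
  by rewrite E mulrCA.
rewrite add0r; apply: eq_bigr => i _.
by rewrite lie_bracketE mulrBl.
Qed.

End Diffeomorphism.

End PushForward.

(** * Holomorphic maps preserve (1,0) vectors *)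

Section HolomorphicMaps.
Context {R : realType} {n : nat}.
Local Notation C := R[i].
Implicit Types (M U : set 'rV[R]_(n + n)) (h g : 'rV[R]_(n + n) -> 'rV[R]_(n + n)).

Lemma analytic_smooth N (f : 'rV[R]_N -> R) p : analytic_at f p -> smooth f p.
Proof. by move=> /analytic_hseries[P [B [r]]]; exact: hseries_smooth. Qed.

Lemma to_complex_Jstruct (v : 'rV[R]_(n + n)) : to_complex (Jstruct v) = 'i%C *: to_complex v.
Proof.
apply/rowP => j; rewrite [LHS]mxE [RHS]mxE /Jstruct row_mxEl row_mxEr !mxE.
by apply: complex_eq => /=; ring.
Qed.

Lemma holomorphic_smooth (f : 'rV[R]_(n + n) -> C) p : holomorphic_at f p -> csmooth f p.
Proof.
by move=> /holomorphic_hseries[P [B [r [_ Hr Hi]]]]; split;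
  [exact: hseries_smooth Hr|exact: hseries_smooth Hi].
Qed.

(* The derivative of [f] at [p] is the degree one part of its expansion, which is
   complex linear. *)
Lemma cauchy_riemann (f : 'rV[R]_(n + n) -> C) p v : holomorphic_at f p ->
  dirderiv f p (Jstruct v) = 'i%C * dirderiv f p v.
Proof.
move=> /holomorphic_hseries[P [B [r [Plin Hr Hi]]]].
have dE u : dirderiv f p u = P 1%N (to_complex u).
  by apply: complex_eq; rewrite /= ?(hseries_derive u Hr) ?(hseries_derive u Hi).
by rewrite !dE to_complex_Jstruct Plin.
Qed.

Lemma holomorphic_map_smooth U h p k : holomorphic_map U h -> U p ->
  smooth (fun x => h x 0 k) p.
Proof.
move=> hh Up; case: (splitP k) => j kj.
  have [+ _] := holomorphic_smooth (hh p Up j).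
  have -> : k = lshift n j by apply: val_inj.
  by congr (smooth _ p); apply/funext => x; rewrite mxE.
have [_ +] := holomorphic_smooth (hh p Up j).
have -> : k = rshift n j by apply: val_inj.
by congr (smooth _ p); apply/funext => x; rewrite mxE.
Qed.

Lemma derive_Jstruct U h p v : holomorphic_map U h -> U p ->
  'D_(Jstruct v) h p = Jstruct ('D_v h p).
Proof.
move=> hh Up; have dh : differentiable h p.
  apply: differentiable_rV => j.
  exact: nbhs_singleton (smooth_differentiable (holomorphic_map_smooth j hh Up)).
apply/rowP => k; rewrite derive_rV//.
have key j : dirderiv (fun x => to_complex (h x) 0 j) p (Jstruct v) =
   'i%C * dirderiv (fun x => to_complex (h x) 0 j) p v := cauchy_riemann v (hh p Up j).
have Rej j : (fun x => complex.Re (to_complex (h x) 0 j)) = fun x => h x 0 (lshift n j).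
  by apply/funext => x; rewrite mxE.
have Imj j : (fun x => complex.Im (to_complex (h x) 0 j)) = fun x => h x 0 (rshift n j).
  by apply/funext => x; rewrite mxE.
case: (splitP k) => j kj.
  have -> : k = lshift n j by apply: val_inj.
  rewrite /Jstruct row_mxEl !mxE derive_rV//.
  have := congr1 (@complex.Re R) (key j).
  by rewrite /dirderiv Rej Imj ReM /= mul0r mul1r sub0r.
have -> : k = rshift n j by apply: val_inj.
rewrite /Jstruct row_mxEr !mxE derive_rV//.
have := congr1 (@complex.Im R) (key j).
by rewrite /dirderiv Rej Imj ImM /= mul0r mul1r add0r.
Qed.

Lemma Jstruct_linear (a : C) (X Y : 'rV[C]_(n + n)) :
  Jstruct (a *: X + Y) = a *: Jstruct X + Jstruct Y.
Proof.
by rewrite /Jstruct !linearP /= -add_row_mx scale_row_mx.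
Qed.

Lemma Jstruct_map (v : 'rV[R]_(n + n)) :
  Jstruct (map_mx (real_complex R) v) = map_mx (real_complex R) (Jstruct v).
Proof. by rewrite /Jstruct map_row_mx map_mxN map_rsubmx map_lsubmx. Qed.

Lemma complex_row_split (X : 'rV[C]_(n + n)) : X =
  'i%C *: map_mx (real_complex R) (map_mx (@complex.Im R) X)
  + map_mx (real_complex R) (map_mx (@complex.Re R) X).
Proof. by apply/rowP => k; rewrite !mxE; apply: complex_eq => /=; ring. Qed.

(** A complex vector is [v + i w] with real [v] and [w]; complex linearity reduces the claim to real
    vectors, where it is the Cauchy-Riemann equations. *)
Lemma dmap_Jstruct U h p (X : 'rV[C]_(n + n)) : holomorphic_map U h -> U p ->
  dmap h p (Jstruct X) = Jstruct (dmap h p X).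
Proof.
move=> hh Up; have dh j : differentiable (fun x => h x 0 j) p.
  exact: nbhs_singleton (smooth_differentiable (holomorphic_map_smooth j hh Up)).
rewrite (complex_row_split X) Jstruct_linear !dmap_linear Jstruct_linear.
set v := map_mx _ X; set w := map_mx _ X.
have E u : dmap h p (Jstruct (map_mx (real_complex R) u)) =
    Jstruct (dmap h p (map_mx (real_complex R) u)).
  by rewrite Jstruct_map (dmap_real u dh) (dmap_real (Jstruct u) dh)
       (derive_Jstruct u hh Up) Jstruct_map.
by rewrite (E v) (E w).
Qed.

Lemma T10_map M U M' U' h p (X : 'rV[C]_(n + n)) : smooth_map M U M' U' h ->
  holomorphic_map U h -> U p -> T10 M p X -> T10 M' (h p) (dmap h p X).
Proof.
move=> sh hh Up [tX JX]; split; first exact: complex_tangent_map sh Up tX.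
by rewrite -(dmap_Jstruct _ hh Up) JX dmapZ.
Qed.

Lemma biholomorphism_smooth_map M M' U U' h g : biholomorphism U U' h g ->
  h @` (M `&` U) = M' `&` U' ->
  [/\ smooth_map M U M' U' h, smooth_map M' U' M U g, forall p, U p -> g (h p) = p
    & forall q, U' q -> h (g q) = q].
Proof.
move=> [[oU oU'] hU gh hh hg'] hM.
have hUU p : U p -> U' (h p) by move=> Up; rewrite -hU; exists p.
have gU q : U' q -> U (g q) /\ h (g q) = q.
  by rewrite -[X in X q]hU => -[p Up <-]; rewrite gh.
have mM p : M p -> U p -> M' (h p).
  move=> Mp Up; have : (M' `&` U') (h p) by rewrite -hM; exists p.
  by case.
have gM q : M' q -> U' q -> M (g q).
  move=> Mq Uq; have : (M' `&` U') q by [].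
  by rewrite -hM => -[p [Mp Up] <-]; rewrite gh.
split => //.
- by split => // p Up k; exact: holomorphic_map_smooth hh Up.
- split => // [q /gU[]//|q Uq k]; exact: holomorphic_map_smooth hg' Uq.
- by move=> q /gU[].
Qed.

Lemma T10_generator_smooth_field M U (L : vfield R (n + n)) : T10_generator M U L ->
  smooth_field M U L.
Proof.
move=> [_ gL] q Mq Uq; have [aL L0 HL] := gL q Mq Uq; split.
  by have [] : T10 M q (L q) by apply/HL; exists 1; rewrite scale1r.
move=> k; have [F [[Fr Fi] FL]] := aL k; exists F => //.
by split; exact: analytic_smooth.
Qed.

End HolomorphicMaps.

(** * Change of generator *)

Section GeneratorRatio.
Context {R : realType} {n : nat}.
Local Notation C := R[i].
Implicit Types (M U V : set 'rV[R]_(n + n)) (L X Y : vfield R (n + n)).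

Lemma smooth_fieldW M U V X : V `<=` U -> smooth_field M U X -> smooth_field M V X.
Proof. by move=> VU sX q Mq Vq; exact: sX (VU q Vq). Qed.

Lemma row_neq0 (X : 'rV[C]_(n + n)) : X != 0 -> exists j, X 0 j != 0.
Proof.
move=> X0; apply/existsP; apply: contraNT X0; rewrite negb_exists => /forallP H.
by apply/eqP/rowP => j; rewrite mxE; have := H j; rewrite negbK => /eqP.
Qed.

(** Since [L] spans the (1,0) vectors, [X] is a multiple of [L] at each point. Smoothness of the
    factor is read off a coordinate [j] with [L p 0 j != 0]: the factor is the quotient of the
    [j]-th coordinates as long as that one stays nonzero, hence only near [p]. *)
Lemma generator_ratio M U U' X L p : open U -> smooth_field M U X ->
  (forall q, M q -> U q -> T10 M q (X q)) -> T10_generator M U' L ->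
  M p -> U p -> U' p ->
  exists V a, [/\ open V, V p, V `<=` U `&` U', smooth_on M V a
    & forall q, M q -> V q -> X q = a q *: L q].
Proof.
move=> oU sX tX gL Mp Up Up'; have [oU' HL] := gL.
have sL := T10_generator_smooth_field gL.
have [_ Lp0 _] := HL p Mp Up'; have [j Lj] := row_neq0 Lp0.
have [_ /(_ j)cLj] := sL p Mp Up'.
have nL : nbhs p [set q | M q -> L q 0 j != 0] := smooth_along_neq0 Mp Lj cLj.
(* An open set is extracted, because the factor will be differentiated at every point of [V]. *)
pose B := interior [set q | M q -> L q 0 j != 0].
have oB : open B by exact: open_interior.
have Bp : B p by [].
have BH : B `<=` [set q | M q -> L q 0 j != 0] := @interior_subset _ _.
exists (U `&` U' `&` B), (fun q => X q 0 j / L q 0 j); split.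
- by apply: openI => //; exact: openI.
- by [].
- by move=> q [].
- move=> q Mq [[Uq Uq'] Bq]; have [_ /(_ j)cX] := sX q Mq Uq.
  have [_ /(_ j)cL] := sL q Mq Uq'.
  by apply: smooth_alongM => //; apply: smooth_alongV => //; exact: BH.
- move=> q Mq [[Uq Uq'] Bq]; have Lq0 := BH q Bq Mq; have [_ _ HLq] := HL q Mq Uq'.
  have [c cE] := (HLq (X q)).1 (tX q Mq Uq).
  by rewrite cE mxE mulfK.
Qed.

(** Not built into [complex_tangent]; a maximally minimal manifold has it because its complex
    tangent vectors form the row space of a matrix. *)
Definition tangent_linear M V := forall q, M q -> V q -> forall (a : C) (X Y : 'rV[C]_(n + n)),
  complex_tangent M q X -> complex_tangent M q Y -> complex_tangent M q (a *: X + Y).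

Lemma maximally_minimal_tangent_linear M V : maximally_minimal M -> tangent_linear M V.
Proof.
move=> mM q Mq _ a X Y; have [U [L [Uq gL /(_ q Mq Uq)[_ HF]]]] := mM q Mq.
by move=> /HF HX /HF HY; apply/HF; rewrite addmx_sub// scalemx_sub.
Qed.

Lemma tangentZ M V q (a : C) (X : 'rV[C]_(n + n)) : tangent_linear M V -> M q -> V q ->
  complex_tangent M q X -> complex_tangent M q (a *: X).
Proof.
move=> tl Mq Vq tX; have t0 : complex_tangent M q 0.
  by have := tl q Mq Vq (-1) _ _ tX tX; rewrite scaleN1r addNr.
by have := tl q Mq Vq a _ _ tX t0; rewrite addr0.
Qed.

Lemma tangentD M V q (X Y : 'rV[C]_(n + n)) : tangent_linear M V -> M q -> V q ->
  complex_tangent M q X -> complex_tangent M q Y -> complex_tangent M q (X + Y).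
Proof. by move=> tl Mq Vq tX tY; have := tl q Mq Vq 1 _ _ tX tY; rewrite scale1r. Qed.

Lemma smooth_field_scale M V X Y f : open V -> tangent_linear M V -> smooth_field M V X ->
  smooth_on M V f -> (forall q, M q -> V q -> Y q = f q *: X q) -> smooth_field M V Y.
Proof.
move=> oV tl sX sf YE q Mq Vq; have [tX cX] := sX q Mq Vq; split.
  by rewrite YE//; exact: tangentZ tl Mq Vq tX.
move=> k; apply: smooth_along_eq (smooth_alongM (sf q Mq Vq) (cX k)).
by apply: eq_on_near Vq => // x Mx Vx; rewrite YE// mxE.
Qed.

Lemma smooth_field_add M V X Y Z : open V -> tangent_linear M V -> smooth_field M V X ->
  smooth_field M V Y -> (forall q, M q -> V q -> Z q = X q + Y q) -> smooth_field M V Z.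
Proof.
move=> oV tl sX sY ZE q Mq Vq; have [tX cX] := sX q Mq Vq; have [tY cY] := sY q Mq Vq.
split; first by rewrite ZE//; exact: tangentD tl Mq Vq tX tY.
move=> k; apply: smooth_along_eq (smooth_alongD (cX k) (cY k)).
by apply: eq_on_near Vq => // x Mx Vx; rewrite ZE// mxE.
Qed.

Lemma scale_Ni_i (X : 'rV[C]_(n + n)) : X = - 'i%C *: ('i%C *: X).
Proof. by rewrite scalerA mulNr -expr2 sqr_i opprK scale1r. Qed.

Lemma conj_mulNi (u v : C) : 'i%C * (u * conjc v) = conjc (- 'i%C * conjc u * v).
Proof. by case: u v => ? ? [? ?]; apply: complex_eq => /=; ring. Qed.

Lemma collect_frame_terms (S T lc l : 'rV[C]_(n + n)) (x y z w u1 u2 u3 u4 u5 u6 : C) :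
  (x * (x * y)) *: S + u1 *: T - u2 *: l + (z *: (w *: T) + u3 *: lc - u4 *: l)
    + (u5 *: l - u6 *: l)
  = (x * x * y) *: S + (u1 + z * w) *: T + u3 *: lc + (u5 - u6 - u2 - u4) *: l.
Proof. by apply/rowP => k; rewrite !mxE; ring. Qed.

Section Ratio.
Variables (M V : set 'rV[R]_(n + n)) (X L : vfield R (n + n)) (a : 'rV[R]_(n + n) -> C).
Hypotheses (oV : open V) (sX : smooth_field M V X) (sL : smooth_field M V L).
Hypotheses (sa : smooth_on M V a) (XE : forall q, M q -> V q -> X q = a q *: L q).

Let ac q := conjc (a q).
Let Lc := conj_field L.
Let b q := - 'i%C * ac q * tangential_deriv M (Lc q) a q.

Lemma smooth_conj_ratio : smooth_on M V ac.
Proof. by move=> q Mq Vq; exact: smooth_along_conj (sa Mq Vq). Qed.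

Lemma smooth_shear : smooth_on M V b.
Proof.
move=> q Mq Vq; apply: smooth_alongM.
  by apply: smooth_alongM; [exact: smooth_along_cst|exact: smooth_conj_ratio].
by apply: (smooth_on_tangential_deriv oV) => //; exact: smooth_field_conj.
Qed.

(** The Leibniz rule puts [i a L(\bar a)] in front of [Lc]; this is the conjugate of [b], whence the
    pair [\bar b], [b] in the third row. *)
Lemma Tfield_ratio q : M q -> V q ->
  Tfield M X q = (a q * ac q) *: Tfield M L q + conjc (b q) *: Lc q + b q *: L q.
Proof.
move=> Mq Vq; rewrite /Tfield.
have XcE x : M x -> V x -> conj_field X x = ac x *: Lc x.
  move=> Mx Vx; rewrite /conj_field XE//; apply/rowP => k; rewrite !mxE.
  by rewrite rmorphM.
rewrite (lie_bracketZ oV sL (smooth_field_conj sL) sX (smooth_field_conj sX)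
  sa smooth_conj_ratio XE XcE Mq Vq).
have [tL cL] := sL Mq Vq.
have E : tangential_deriv M (L q) ac q = conjc (tangential_deriv M (Lc q) a q).
  rewrite -(tangential_deriv_conj (complex_tangent_conj tL) (sa Mq Vq)).
  congr tangential_deriv; apply/rowP => k; rewrite !mxE.
  by rewrite conjcK.
rewrite E; set D := tangential_deriv M (Lc q) a q; set B := lie_bracket _ _ _ _.
rewrite scalerBr scalerDr !scalerA -scaleNr.
congr (_ + _ + _); congr (_ *: _).
- by rewrite mulrC.
- by rewrite /b -/D /ac conj_mulNi.
- by rewrite /b -/D mulrA -!mulNr.
Qed.

Lemma lie_bracket_self q : lie_bracket M L L q = 0.
Proof. by apply/rowP => k; rewrite lie_bracketE subrr mxE. Qed.

(** Bracketing [a L] with the three terms of [Tfield M X] produces only the brackets of [L] with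
    [T], with [\bar L] and with itself: the first is [S], the second is [- i T] and joins the
    coefficient [c], the third vanishes. No bracket of [\bar L] with [T] arises, hence the zero
    before [\bar S'] in the second row. *)
Lemma Sfield_ratio q : tangent_linear M V -> M q -> V q ->
  (forall x, M x -> V x -> complex_tangent M x (Tfield M L x)) ->
  exists c d e, Sfield M X q = (a q * a q * ac q) *: Sfield M L q
    + c *: Tfield M L q + d *: Lc q + e *: L q.
Proof.
move=> tl Mq Vq tT.
have sT : smooth_field M V (Tfield M L).
  move=> x Mx Vx; split; first exact: tT.
  move=> k; have := smooth_alongM (smooth_along_cst M 'i%C x)
    (smooth_on_bracket oV k sL (smooth_field_conj sL) Mx Vx).
  by apply: smooth_along_eq; apply: nearT => y _; rewrite /Tfield [RHS]mxE.
pose A1 x := (a x * ac x) *: Tfield M L x.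
pose A2 x := conjc (b x) *: Lc x.
pose A3 x := b x *: L x.
have s1 : smooth_on M V (fun x => a x * ac x).
  by move=> x Mx Vx; exact: smooth_alongM (sa Mx Vx) (smooth_conj_ratio Mx Vx).
have s2 : smooth_on M V (fun x => conjc (b x)).
  by move=> x Mx Vx; exact: smooth_along_conj (smooth_shear Mx Vx).
have sA1 : smooth_field M V A1 by apply: (smooth_field_scale oV tl sT s1).
have sA2 : smooth_field M V A2 by apply: (smooth_field_scale oV tl (smooth_field_conj sL) s2).
have sA3 : smooth_field M V A3 by apply: (smooth_field_scale oV tl sL smooth_shear).
have sA12 : smooth_field M V (fun x => A1 x + A2 x) by apply: (smooth_field_add oV tl sA1 sA2).
have sTX : smooth_field M V (Tfield M X).
  by apply: (smooth_field_add oV tl sA12 sA3) => x Mx Vx; rewrite Tfield_ratio.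
rewrite /Sfield (lie_bracketDr oV sX sA12 sA3 sTX) //; last first.
  by move=> x Mx Vx; rewrite Tfield_ratio.
rewrite (lie_bracketDr oV sX sA1 sA2 sA12)//.
rewrite (lie_bracketZ oV sL sT sX sA1 sa s1 XE (fun _ _ _ => erefl) Mq Vq).
rewrite (lie_bracketZ oV sL (smooth_field_conj sL) sX sA2 sa s2 XE (fun _ _ _ => erefl) Mq Vq).
rewrite (lie_bracketZ oV sL sL sX sA3 sa smooth_shear XE (fun _ _ _ => erefl) Mq Vq).
rewrite lie_bracket_self scaler0 add0r.
have -> : lie_bracket M L Lc q = - 'i%C *: Tfield M L q by exact: scale_Ni_i.
by do 3 eexists; exact: collect_frame_terms.
Qed.

End Ratio.

(** Maximal minimality supplies a frame for some generator near each point, not for the given [L];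
    the ratio of the two generators carries tangency over. *)
Lemma Tfield_tangent M U (L : vfield R (n + n)) : maximally_minimal M -> T10_generator M U L ->
  forall q, M q -> U q -> complex_tangent M q (Tfield M L q).
Proof.
move=> mM gL q Mq Uq; have [U' [L' [Uq' gL' HF]]] := mM q Mq.
have sL := T10_generator_smooth_field gL; have sL' := T10_generator_smooth_field gL'.
have tL x : M x -> U x -> T10 M x (L x).
  by move=> Mx Ux; have [_ /(_ x Mx Ux)[_ _ H]] := gL; apply/H; exists 1; rewrite scale1r.
have [V [a [oV Vq VU sa aE]]] := generator_ratio gL.1 sL tL gL' Mq Uq Uq'.
have VU1 : V `<=` U by move=> x /VU[].
have VU2 : V `<=` U' by move=> x /VU[].
have tl := @maximally_minimal_tangent_linear M V mM.
have sLV := smooth_fieldW VU1 sL; have sLV' := smooth_fieldW VU2 sL'.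
rewrite (Tfield_ratio oV sLV sLV' sa aE Mq Vq).
have [tLq _] := sLV' q Mq Vq.
have tTq : complex_tangent M q (Tfield M L' q).
  have [_ H] := HF q Mq Uq'; apply/H.
  have -> : Tfield M L' q = row (@Ordinal 5 2 isT) (frame_mx (frame M L') q).
    by apply/rowP => k; rewrite [RHS]mxE [RHS]mxE.
  exact: row_sub.
have tLc : complex_tangent M q (conj_field L' q) := complex_tangent_conj tLq.
apply: (tangentD tl Mq Vq); last exact: tangentZ tl Mq Vq tLq.
by apply: (tangentD tl Mq Vq); [exact: tangentZ tl Mq Vq tTq|exact: tangentZ tl Mq Vq tLc].
Qed.

End GeneratorRatio.

(** * The transition matrix between the frames *)

Section FrameTransition.
Context {R : realType}.
Local Notation C := R[i].
Local Notation i0 := (@Ordinal 5 0 isT).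
Local Notation i1 := (@Ordinal 5 1 isT).
Local Notation i2 := (@Ordinal 5 2 isT).
Local Notation i3 := (@Ordinal 5 3 isT).
Local Notation i4 := (@Ordinal 5 4 isT).

Lemma conj_fieldK N (X : vfield R N) : conj_field (conj_field X) = X.
Proof. by apply/funext => p; apply/rowP => k; rewrite !mxE conjcK. Qed.

Lemma frame_mx_ambiguity n (F G : 5.-tuple (vfield R (n + n))) q (a b c d e : C) :
  tnth F i0 q = (a * conjc a * conjc a) *: tnth G i0 q + conjc c *: tnth G i2 q
    + conjc e *: tnth G i3 q + conjc d *: tnth G i4 q ->
  tnth F i1 q = (a * a * conjc a) *: tnth G i1 q + c *: tnth G i2 q
    + d *: tnth G i3 q + e *: tnth G i4 q ->
  tnth F i2 q = (a * conjc a) *: tnth G i2 q + conjc b *: tnth G i3 q + b *: tnth G i4 q ->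
  tnth F i3 q = conjc a *: tnth G i3 q ->
  tnth F i4 q = a *: tnth G i4 q ->
  frame_mx F q = ambiguity_mx a b c d e *m frame_mx G q.
Proof.
have sum5 (f : 'I_5 -> C) : \sum_i f i = f i0 + f i1 + f i2 + f i3 + f i4.
  rewrite !big_ord_recl big_ord0 addr0 !addrA.
  by congr (_ + _ + _ + _ + _); congr f; apply: val_inj.
move=> E0 E1 E2 E3 E4; apply/matrixP => i j; rewrite [LHS]mxE [RHS]mxE sum5 !mxE.
case: i => [[|[|[|[|[|//]]]]] Hi] /=; rewrite (bool_irrelevance Hi isT).
- by rewrite E0 !mxE mul0r addr0.
- by rewrite E1 !mxE mul0r add0r.
- by rewrite E2 !mxE !mul0r !add0r.
- by rewrite E3 !mxE !mul0r !add0r addr0.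
- by rewrite E4 !mxE !mul0r !add0r.
Qed.

Section Reality.
Variables (n : nat) (M V : set 'rV[R]_(n + n)) (L : vfield R (n + n)).
Hypotheses (oV : open V) (sL : smooth_field M V L).

(** Conjugation turns the bracket of [L] and [\bar L] into its negative and [i] into [- i]; the
    signs cancel. *)
Lemma Tfield_conj q : M q -> V q -> map_mx conjc (Tfield M L q) = Tfield M L q.
Proof.
move=> Mq Vq; rewrite {1}/Tfield.
have -> (X : 'rV[C]_(n + n)) : map_mx conjc ('i%C *: X) = - 'i%C *: map_mx conjc X.
  by apply/rowP => k; rewrite !mxE rmorphM; congr (_ * _); apply: complex_eq => /=; ring.
rewrite -(lie_bracket_conj sL (smooth_field_conj sL) Mq Vq) conj_fieldK lie_bracketC.
by rewrite scalerN scaleNr opprK.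
Qed.

Hypothesis tT : forall q, M q -> V q -> complex_tangent M q (Tfield M L q).

Lemma Tfield_smooth : smooth_field M V (Tfield M L).
Proof.
move=> q Mq Vq; split; first exact: tT.
move=> k; have := smooth_alongM (smooth_along_cst M 'i%C q)
  (smooth_on_bracket oV k sL (smooth_field_conj sL) Mq Vq).
by apply: smooth_along_eq; apply: nearT => y _; rewrite /Tfield [RHS]mxE.
Qed.

Lemma Sbfield_conj q : M q -> V q -> Sbfield M L q = map_mx conjc (Sfield M L q).
Proof.
move=> Mq Vq; have sT := Tfield_smooth.
rewrite /Sbfield /Sfield -(lie_bracket_conj sL sT Mq Vq).
apply: (lie_bracket_eq oV (smooth_field_conj sL) (smooth_field_conj sT) _ _ Mq Vq) => //.
by move=> x Mx Vx; rewrite /conj_field Tfield_conj.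
Qed.

End Reality.

Section PushFrame.
Variables (n : nat) (M M' U U' : set 'rV[R]_(n + n)) (h g : 'rV[R]_(n + n) -> 'rV[R]_(n + n)).
Variable L : vfield R (n + n).
Hypotheses (sh : smooth_map M U M' U' h) (sg : smooth_map M' U' M U g).
Hypotheses (gh : forall p, U p -> g (h p) = p) (hg : forall q, U' q -> h (g q) = q).
Hypothesis sL : smooth_field M U L.

Let X := push_field h g L.

Lemma push_conj_field Y : push_field h g (conj_field Y) = conj_field (push_field h g Y).
Proof. by apply/funext => q; exact: dmap_conj. Qed.

Lemma push_Tfield q : M' q -> U' q -> push_field h g (Tfield M L) q = Tfield M' X q.
Proof.
move=> Mq Uq; rewrite /Tfield -push_conj_field.
rewrite (push_field_bracket sh sg gh hg sL (smooth_field_conj sL) Mq Uq).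
exact: dmapZ.
Qed.

Hypothesis tT : forall p, M p -> U p -> complex_tangent M p (Tfield M L p).

Lemma push_Tfield_bracket Y q : smooth_field M U Y -> M' q -> U' q ->
  push_field h g (lie_bracket M Y (Tfield M L)) q
  = lie_bracket M' (push_field h g Y) (Tfield M' X) q.
Proof.
move=> sY Mq Uq; have [oU _ _ _] := sh; have [oU' _ _ _] := sg.
have sT := Tfield_smooth oU sL tT.
rewrite -(push_field_bracket sh sg gh hg sY sT Mq Uq); apply/esym.
apply: (lie_bracket_eq oU' (push_field_smooth sh sg hg sY)
  (push_field_smooth sh sg hg sT) _ _ Mq Uq) => //.
by move=> x Mx Ux; rewrite push_Tfield.
Qed.

Lemma push_Sfield q : M' q -> U' q -> push_field h g (Sfield M L) q = Sfield M' X q.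
Proof. exact: push_Tfield_bracket. Qed.

Lemma push_Sbfield q : M' q -> U' q -> push_field h g (Sbfield M L) q = Sbfield M' X q.
Proof.
move=> Mq Uq; rewrite /Sbfield -push_conj_field.
by apply: push_Tfield_bracket => //; exact: smooth_field_conj.
Qed.

End PushFrame.

Lemma frame_transition n (M M' : set 'rV[R]_(n + n)) (U U' : set 'rV[R]_(n + n))
    (h g : 'rV[R]_(n + n) -> 'rV[R]_(n + n)) (L L' : vfield R (n + n)) :
  maximally_minimal M' -> biholomorphism U U' h g -> h @` (M `&` U) = M' `&` U' ->
  T10_generator M U L -> T10_generator M' U' L' ->
  forall q, M' q -> U' q -> exists a b c d e,
    a != 0 /\ frame_mx (map_tuple (push_field h g) (frame M L)) q
              = ambiguity_mx a b c d e *m frame_mx (frame M' L') q.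
Proof.
move=> mM' bih hM gL gL'.
have [sh sg gh hg] := biholomorphism_smooth_map bih hM.
have [oU hU hMM _] := sh; have [oU' gU gMM _] := sg.
have [_ _ _ hh _] := bih.
have sL := T10_generator_smooth_field gL; have sL' := T10_generator_smooth_field gL'.
pose X := push_field h g L.
have sX : smooth_field M' U' X := push_field_smooth sh sg hg sL.
have tX q : M' q -> U' q -> T10 M' q (X q).
  move=> Mq Uq; have [_ /(_ (g q) (gMM q Mq Uq) (gU q Uq))[_ _ H]] := gL.
  have tLp : T10 M (g q) (L (g q)) by apply/H; exists 1; rewrite scale1r.
  by have := T10_map sh hh (gU q Uq) tLp; rewrite hg.
have tT' := Tfield_tangent mM' gL'.
have ratio q : M' q -> U' q -> exists V a, [/\ open V, V q, V `<=` U' `&` U', smooth_on M' V a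
    & forall x, M' x -> V x -> X x = a x *: L' x].
  by move=> Mq Uq; exact: (generator_ratio oU' sX tX gL' Mq Uq Uq).
have tTX q : M' q -> U' q -> complex_tangent M' q (Tfield M' X q).
  move=> Mq Uq; have [V [a [oV Vq VU sa aE]]] := ratio q Mq Uq.
  have VU' : V `<=` U' by move=> x /VU[].
  have tl := @maximally_minimal_tangent_linear _ _ M' V mM'.
  rewrite (Tfield_ratio oV (smooth_fieldW VU' sX) (smooth_fieldW VU' sL') sa aE Mq Vq).
  have [tL _] := sL' q Mq Uq.
  apply: (tangentD tl Mq Vq); last exact: tangentZ tl Mq Vq tL.
  apply: (tangentD tl Mq Vq); first exact: tangentZ tl Mq Vq (tT' q Mq Uq).
  exact: tangentZ tl Mq Vq (complex_tangent_conj tL).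
(* [push_Tfield] is already available, as it brackets only [L] and its conjugate; [push_Sfield]
   brackets with [T] itself and becomes available only with this tangency. *)
have tT p : M p -> U p -> complex_tangent M p (Tfield M L p).
  move=> Mp Up; have Mh := hMM p Mp Up; have Uh := hU p Up.
  rewrite -(dmapK sh sg gh (Tfield M L p) Up).
  have := complex_tangent_map sg Uh (tTX _ Mh Uh).
  by rewrite gh// -(push_Tfield sh sg gh hg sL Mh Uh) /push_field gh.
move=> q Mq Uq; have [V [a [oV Vq VU sa aE]]] := ratio q Mq Uq.
have VU' : V `<=` U' by move=> x /VU[].
have tl := @maximally_minimal_tangent_linear _ _ M' V mM'.
have sXV := smooth_fieldW VU' sX; have sLV := smooth_fieldW VU' sL'.
have TE := Tfield_ratio oV sXV sLV sa aE Mq Vq.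
have tTV x : M' x -> V x -> complex_tangent M' x (Tfield M' L' x).
  by move=> Mx Vx; apply: tT' => //; exact: VU'.
have [c [d [e SE]]] := Sfield_ratio oV sXV sLV sa aE tl Mq Vq tTV.
set b := - 'i%C * _ * _ in TE.
(* If [a] vanished at [q], so would [h_* L], and applying the differential of [g] would make the
   generator [L] vanish at [g q]. *)
have aq0 : a q != 0.
  have [_ /(_ (g q) (gMM q Mq Uq) (gU q Uq))[_ L0 _]] := gL.
  apply: contraNneq L0 => a0; have := dmapK sh sg gh (L (g q)) (gU q Uq).
  have -> : dmap h (g q) (L (g q)) = X q by [].
  rewrite aE// a0 scale0r => <-; rewrite hg//.
  by apply/eqP/rowP => k; rewrite !mxE /apply_vect big1// => i _; rewrite mxE mul0r.
exists (a q), b, c, d, e; split => //.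
have cE (x y z w : C) (A B D E : 'rV[C]_(n + n)) :
   map_mx conjc (x *: A + y *: B + z *: D + w *: E) =
   conjc x *: map_mx conjc A + conjc y *: map_mx conjc B + conjc z *: map_mx conjc D
   + conjc w *: map_mx conjc E.
  by apply/rowP => k; rewrite !mxE !rmorphD !rmorphM.
apply: frame_mx_ambiguity.
- have -> : tnth (map_tuple (push_field h g) (frame M L)) i0 q = Sbfield M' X q.
    rewrite tnth_map; exact: (push_Sbfield sh sg gh hg sL tT Mq Uq).
  rewrite (Sbfield_conj oU' sX tTX Mq Uq) SE cE.
  have -> : map_mx conjc (Sfield M' L' q) = tnth (frame M' L') i0 q.
    by rewrite -(Sbfield_conj oU' sL' tT' Mq Uq).
  rewrite (Tfield_conj sL' Mq Uq).
  have -> : map_mx conjc (conj_field L' q) = L' q by have /(congr1 (@^~ q)) := conj_fieldK L'.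
  have -> : conjc (a q * a q * conjc (a q)) = a q * conjc (a q) * conjc (a q).
    by rewrite !rmorphM /= conjcK mulrC mulrA.
  (* Conjugating the second row exchanges [L'] with its conjugate, which explains the order
     [\bar e], [\bar d] in the first row. *)
  by rewrite addrAC.
- have -> : tnth (map_tuple (push_field h g) (frame M L)) i1 q = Sfield M' X q.
    rewrite tnth_map; exact: (push_Sfield sh sg gh hg sL tT Mq Uq).
  exact: SE.
- have -> : tnth (map_tuple (push_field h g) (frame M L)) i2 q = Tfield M' X q.
    rewrite tnth_map; exact: (push_Tfield sh sg gh hg sL Mq Uq).
  exact: TE.
- have -> : tnth (map_tuple (push_field h g) (frame M L)) i3 q = conj_field X q.
    by rewrite tnth_map -push_conj_field.
  have -> : tnth (frame M' L') i3 q = conj_field L' q by [].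
  by rewrite /conj_field aE//; apply/rowP => k; rewrite !mxE rmorphM.
- by rewrite tnth_map; exact: aE.
Qed.

End FrameTransition.

(** * Polynomials are real analytic *)

Section PolynomialFunctions.
Context {R : realType} {N : nat}.
Implicit Types (f g : 'rV[R]_N -> R) (p x : 'rV[R]_N).

(** Monomials are centred at [p], so that the list is already an expansion at [p]; repeated
    exponents are allowed, which makes addition a concatenation. *)
Definition polynomial_at f p := exists l : seq (R * {ffun 'I_N -> nat}),
  forall x, f x = \sum_(t <- l) t.1 * monomial (x - p) t.2.

Lemma polynomial_atD f g p : polynomial_at f p -> polynomial_at g p ->
  polynomial_at (fun x => f x + g x) p.
Proof. by move=> [l fl] [m gm]; exists (l ++ m) => x; rewrite big_cat fl gm. Qed.

Lemma monomialD x (al be : {ffun 'I_N -> nat}) :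
  monomial x [ffun i => al i + be i]%N = monomial x al * monomial x be.
Proof.
by rewrite /monomial -big_split; apply: eq_bigr => i _; rewrite ffunE exprD.
Qed.

Lemma polynomial_atM f g p : polynomial_at f p -> polynomial_at g p ->
  polynomial_at (fun x => f x * g x) p.
Proof.
move=> [l fl] [m gm].
exists (allpairs (fun t s : R * {ffun 'I_N -> nat} =>
  (t.1 * s.1, [ffun i => t.2 i + s.2 i]%N)) l m) => x.
rewrite big_allpairs_dep fl gm mulr_suml; apply: eq_bigr => t _.
by rewrite mulr_sumr; apply: eq_bigr => s _ /=; rewrite monomialD mulrACA.
Qed.

Lemma polynomial_at_cst c p : polynomial_at (fun=> c) p.
Proof.
exists [:: (c, [ffun=> 0%N])] => x; rewrite big_seq1 /= /monomial big1 ?mulr1// => i _.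
by rewrite ffunE.
Qed.

Lemma polynomial_atN f p : polynomial_at f p -> polynomial_at (fun x => - f x) p.
Proof.
move=> Pf; have [l fl] := polynomial_atM (polynomial_at_cst (-1) p) Pf.
by exists l => x; rewrite -fl mulN1r.
Qed.

Lemma polynomial_at_coord i p : polynomial_at (fun x => x 0 i) p.
Proof.
have [l fl] := polynomial_at_cst (p 0 i) p.
exists ((1, [ffun j => (j == i) : nat]) :: l) => x.
rewrite big_cons -fl /= mul1r /monomial (bigD1 i)//= big1 ?mulr1.
  by rewrite ffunE eqxx expr1 !mxE subrK.
by move=> j /negbTE ji; rewrite ffunE ji.
Qed.

(** The index type of [sum_degree k] bounds every entry by [k]; an exponent of total degree [k]
    fits, since an entry never exceeds the sum. *)
Lemma sum_degree_pred1 k (be : {ffun 'I_N -> nat}) (w : R) :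
  sum_degree k (fun al => if be == al then w else 0)
  = if (\sum_i be i == k)%N then w else 0.
Proof.
rewrite /sum_degree -big_mkcondr; case: eqP => bek.
  have bk i : (be i < k.+1)%N by rewrite -bek ltnS (bigD1 i)//= leq_addr.
  have beE : be = [ffun i => ([ffun i => inord (be i)] : {ffun 'I_N -> 'I_k.+1}) i : nat].
    by apply/ffunP => i; rewrite !ffunE inordK.
  rewrite (big_pred1 ([ffun i => inord (be i)] : {ffun 'I_N -> 'I_k.+1}))// => al /=.
  apply/andP/eqP => [[_ /eqP beal]|->].
    apply/ffunP => i; have bi : be i = al i by rewrite [in LHS]beal ffunE.
    by rewrite ffunE bi inord_val.
  split; last exact/eqP.
  by rewrite -[X in _ == X]bek; apply/eqP/eq_bigr => i _; rewrite ffunE inordK.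
rewrite big1// => al /andP[/eqP alk /eqP beal]; case: bek; rewrite beal -[RHS]alk.
by apply: eq_bigr => i _; rewrite ffunE.
Qed.

Lemma series_stationary (u : nat -> R) D : (forall k, (D <= k)%N -> u k = 0) ->
  series u @ \oo --> series u D.
Proof.
move=> u0; apply: cvg_near_cst; exists D => // k /= Dk.
have z : \sum_(D <= i < k) u i = 0.
  by rewrite big_nat_cond big1// => i /andP[/andP[Di _] _]; exact: u0.
by rewrite !seriesEnat /= (big_cat_nat (leq0n D) Dk)/= z addr0.
Qed.

Lemma polynomial_analytic f p : polynomial_at f p -> analytic_at f p.
Proof.
move=> [l fl]; pose deg (be : {ffun 'I_N -> nat}) := (\sum_i be i)%N.
(* Collects the repeated exponents of the list into one coefficient each. *)
pose c al := \sum_(t <- l) if t.2 == al then t.1 else 0.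
exists c, 1; split => // x _.
(* The sum of all degrees, plus one, exceeds each of them, so both series are stationary from [D]
   on; any radius would do, and [1] is taken. *)
pose D := (\sum_(t <- l) deg t.2).+1.
have degD t : t \in l -> (deg t.2 < D)%N.
  by move=> tl; rewrite /D ltnS (big_rem t)//= leq_addr.
have sdE k : sum_degree k (fun al => c al * monomial (x - p) al) =
    \sum_(t <- l) if deg t.2 == k then t.1 * monomial (x - p) t.2 else 0.
  under [RHS]eq_bigr do rewrite /deg -sum_degree_pred1.
  rewrite /sum_degree exchange_big; apply: eq_bigr => al _ /=.
  rewrite /c mulr_suml; apply: eq_bigr => t _.
  by case: eqP => [->//|_]; rewrite mul0r.
have sd0 k : (D <= k)%N -> forall t, t \in l -> (deg t.2 == k) = false.
  by move=> Dk t tl; rewrite ltn_eqF// (leq_trans (degD t tl)).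
split.
  pose u k := sum_degree k (fun al => `|c al * monomial (x - p) al|).
  suff cu : series u @ \oo --> series u D by exact: cvgP cu.
  apply: series_stationary => k Dk.
  apply: big1 => al /eqP alk; rewrite /c big_seq big1 ?mul0r ?normr0// => t tl.
  case: eqP => // tal; have := sd0 k Dk t tl; rewrite tal -[X in _ == X]alk.
  by move=> /eqP[]; apply: eq_bigr => i _; rewrite ffunE.
have -> : f x = series (fun k => sum_degree k (fun al => c al * monomial (x - p) al)) D.
  rewrite seriesEnat /= (eq_bigr _ (fun k _ => sdE k)) exchange_big /= fl.
  rewrite big_seq [RHS]big_seq; apply: eq_bigr => t tl.
  by rewrite -big_mkcond /= big_mkord (big_pred1 (Ordinal (degD t tl))).
apply: (@series_stationary (fun k => sum_degree k (fun al => c al * monomial (x - p) al)) D).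
move=> k Dk; rewrite sdE big_seq big1// => t tl.
by rewrite (sd0 k Dk t tl).
Qed.

End PolynomialFunctions.

(** * The matrix group and its manifold structure *)

Section AmbiguityGroup.
Context {R : realType}.
Local Notation C := R[i].
Local Notation i0 := (@Ordinal 5 0 isT).
Local Notation i1 := (@Ordinal 5 1 isT).
Local Notation i2 := (@Ordinal 5 2 isT).
Local Notation i3 := (@Ordinal 5 3 isT).
Local Notation i4 := (@Ordinal 5 4 isT).

Lemma ambiguity_mxM (a b c d e a' b' c' d' e' : C) :
  ambiguity_mx a b c d e *m ambiguity_mx a' b' c' d' e' =
  ambiguity_mx (a * a') (a * conjc a * b' + b * a')
    (a * a * conjc a * c' + c * (a' * conjc a'))
    (a * a * conjc a * d' + c * conjc b' + d * conjc a')
    (a * a * conjc a * e' + c * b' + e * a').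
Proof.
apply/matrixP => i j; rewrite mxE !big_ord_recl big_ord0 !mxE /=.
case: i => [[|[|[|[|[|//]]]]] Hi]; case: j => [[|[|[|[|[|//]]]]] Hj];
  rewrite /= ?(rmorphD, rmorphM) /= ?conjcK; ring.
Qed.

Lemma ambiguity_mx1 : ambiguity_mx 1 0 0 0 0 = 1%:M :> 'M[C]_5.
Proof.
apply/matrixP => i j; rewrite !mxE -val_eqE.
case: i => [[|[|[|[|[|//]]]]] Hi]; case: j => [[|[|[|[|[|//]]]]] Hj];
  rewrite /=; apply: complex_eq => /=; ring.
Qed.

(** The group law of [ambiguity_mxM] is triangular in the parameters of the second factor: [a'] and
    then [b'], [c'], [d'], [e'] are solved for in turn, dividing by [a], [a \bar a] and
    [a a \bar a]. *)
Lemma ambiguity_mx_inverse (a b c d e : C) : a != 0 ->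
  exists a' b' c' d' e', a' != 0 /\
    ambiguity_mx a b c d e *m ambiguity_mx a' b' c' d' e' = 1%:M.
Proof.
move=> a0; have ac0 : conjc a != 0 by rewrite conjc_eq0.
pose a' := a^-1; pose b' := - (b * a') / (a * conjc a).
pose u := a * a * conjc a; have u0 : u != 0 by rewrite !mulf_neq0.
pose c' := - (c * (a' * conjc a')) / u.
pose d' := - (c * conjc b' + d * conjc a') / u.
pose e' := - (c * b' + e * a') / u.
exists a', b', c', d', e'; split; first by rewrite invr_eq0.
rewrite ambiguity_mxM -ambiguity_mx1; congr ambiguity_mx; rewrite -/u.
- by rewrite mulfV.
- by rewrite /b' mulrC divfK ?addNr// mulf_neq0.
- by rewrite /c' mulrC divfK// addNr.
- by rewrite /d' -addrA [u * _]mulrC divfK// addNr.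
- by rewrite /e' -addrA [u * _]mulrC divfK// addNr.
Qed.

Definition ambiguity_group : set 'M[C]_5 :=
  [set A | exists a b c d e : C, a != 0 /\ A = ambiguity_mx a b c d e].

Lemma ambiguity_subgroup : subgroup_of_GL ambiguity_group.
Proof.
split.
- move=> A [a [b [c [d [e [a0 ->]]]]]].
  have [a' [b' [c' [d' [e' [_ /mulmx1_unit[]]]]]]] := ambiguity_mx_inverse b c d e a0.
  by [].
- by exists 1, 0, 0, 0, 0; rewrite oner_neq0 ambiguity_mx1.
- move=> A B [a [b [c [d [e [a0 ->]]]]]] [a' [b' [c' [d' [e' [a0' ->]]]]]].
  by rewrite ambiguity_mxM; do 5 eexists; split; last reflexivity; exact: mulf_neq0.
- move=> A [a [b [c [d [e [a0 ->]]]]]].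
  have [a' [b' [c' [d' [e' [a0' E]]]]]] := ambiguity_mx_inverse b c d e a0.
  exists a', b', c', d', e'; split => //.
  have [uA _] := mulmx1_unit E.
  by rewrite -[LHS]mulmx1 -E mulmxA mulVmx// mul1mx.
Qed.

(** The entries arise from the parameters by products and conjugation alone, apart from zeros. This
    one case analysis serves both smoothness and polynomiality. *)
Lemma ambiguity_mx_closed N (P : ('rV[R]_N -> C) -> Prop) :
  P (fun=> 0) -> (forall f g, P f -> P g -> P (fun x => f x * g x)) ->
  (forall f, P f -> P (fun x => conjc (f x))) ->
  forall a b c d e, P a -> P b -> P c -> P d -> P e ->
  forall i j, P (fun x => ambiguity_mx (a x) (b x) (c x) (d x) (e x) i j).
Proof.
move=> P0 PM PC a b c d e Pa Pb Pc Pd Pe i j.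
have -> : (fun x => ambiguity_mx (a x) (b x) (c x) (d x) (e x) i j) =
  fun x => nth 0 (nth [::]
    [:: [:: a x * conjc (a x) * conjc (a x); 0; conjc (c x); conjc (e x); conjc (d x)];
        [:: 0; a x * a x * conjc (a x); c x; d x; e x];
        [:: 0; 0; a x * conjc (a x); conjc (b x); b x];
        [:: 0; 0; 0; conjc (a x); 0];
        [:: 0; 0; 0; 0; a x]] i) j by apply/funext => x; rewrite mxE.
have Pac := PC _ Pa; have Paac := PM _ _ Pa Pac.
case: i => [[|[|[|[|[|//]]]]] Hi]; case: j => [[|[|[|[|[|//]]]]] Hj] /=;
  first [exact P0|exact Pa|exact Pb|exact Pc|exact Pd|exact Pe|exact Pac|exact Paac
    |exact (PC _ Pb)|exact (PC _ Pc)|exact (PC _ Pd)|exact (PC _ Pe)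
    |exact (PM _ _ Paac Pac)|exact (PM _ _ (PM _ _ Pa Pa) Pac)].
Qed.

Lemma of_complexK n : cancel (@of_complex R n) (@to_complex R n).
Proof.
by move=> z; apply/rowP => j; rewrite mxE row_mxEl row_mxEr !mxE; case: (z 0 j).
Qed.

Definition coords_mx n (x : 'rV[R]_(n * n + n * n)) : 'M[C]_n := vec_mx (to_complex x).

Lemma mx_coordsK n : cancel (@mx_coords R n) (@coords_mx n).
Proof. by move=> A; rewrite /coords_mx of_complexK mxvecK. Qed.

Lemma csmooth_to_complex n j (p : 'rV[R]_(n + n)) : csmooth (fun x => to_complex x 0 j) p.
Proof.
by split=> k; [apply: near_eq_Ck (Ck_coord k (lshift n j) p)
  |apply: near_eq_Ck (Ck_coord k (rshift n j) p)]; apply: nearT => x; rewrite mxE.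
Qed.

Lemma csmooth_coords_mx n i j (p : 'rV[R]_(n * n + n * n)) :
  csmooth (fun x => coords_mx x i j) p.
Proof.
have := csmooth_to_complex (mxvec_index i j) p; congr (csmooth _ p).
by apply/funext => x; rewrite [RHS]mxE.
Qed.

(* The entries carrying the parameters [a], [b], [c], [d], [e]. *)
Definition param_pos (k : 'I_5) : 'I_5 * 'I_5 :=
  nth (i4, i4) [:: (i4, i4); (i2, i4); (i1, i2); (i1, i3); (i1, i4)] k.

Definition params (A : 'M[C]_5) : 'rV[C]_5 := \row_k A (param_pos k).1 (param_pos k).2.

Definition of_params (z : 'rV[C]_5) : 'M[C]_5 :=
  ambiguity_mx (z 0 i0) (z 0 i1) (z 0 i2) (z 0 i3) (z 0 i4).

Lemma of_paramsK : cancel of_params params.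
Proof.
move=> z; apply/rowP => k; rewrite !mxE.
by case: k => [[|[|[|[|[|//]]]]] Hk] /=; congr (z 0 _); apply: val_inj.
Qed.

Lemma ambiguity_groupE A : ambiguity_group A <-> params A 0 i0 != 0 /\ A = of_params (params A).
Proof.
split=> [[a [b [c [d [e [a0 ->]]]]]]|[a0 ->]]; last by do 5 eexists; split; last reflexivity.
pose z : 'rV[C]_5 := \row_k nth 0 [:: a; b; c; d; e] k.
have -> : ambiguity_mx a b c d e = of_params z by rewrite /of_params !mxE.
by rewrite of_paramsK mxE.
Qed.

Lemma csmooth_of_params N (f : 'rV[R]_N -> 'rV[C]_5) p :
  (forall k, csmooth (fun x => f x 0 k) p) ->
  forall i j, csmooth (fun x => of_params (f x) i j) p.
Proof.
move=> sf; apply: (@ambiguity_mx_closed _ (fun F => csmooth F p)) => //; first exact: csmooth_cst.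
  by move=> *; exact: csmoothM.
by move=> *; exact: csmooth_conj.
Qed.

(** The closed set is the fixed locus of reading off the parameters and rebuilding the matrix. It
    does not impose [a != 0], which is not a closed condition; an invertible matrix of this shape
    satisfies it anyway, because its last row is zero except for [a]. *)
Lemma ambiguity_closed_in_GL : closed_in_GL ambiguity_group.
Proof.
exists [set x | coords_mx x = of_params (params (coords_mx x))]; last first.
  move=> A uA; rewrite /= mx_coordsK; split=> [/ambiguity_groupE[]//|AE].
  apply/ambiguity_groupE; split => //.
  apply: contraTneq uA => a0; rewrite AE unitmxE; have : row i4 A = 0.
    by apply/rowP => j; rewrite AE /of_params a0 !mxE; case: j => [[|[|[|[|[|//]]]]] Hj].
  move=> r0; rewrite -AE (expand_det_row _ i4) big1 ?unitr0// => j _.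
  by have /rowP/(_ j) := r0; rewrite !mxE => ->; rewrite mul0r.
rewrite -openC openE => x /= Fx.
have [i [j Dij]] : exists i j, coords_mx x i j - of_params (params (coords_mx x)) i j != 0.
  apply: contrapT => H; apply: Fx; apply/matrixP => i j; apply/eqP; rewrite -subr_eq0.
  by apply: contrapT => /negP Dij; apply: H; exists i, j.
have sD : csmooth (fun y => coords_mx y i j + (-1) * of_params (params (coords_mx y)) i j) x.
  apply: csmoothD; first exact: csmooth_coords_mx.
  apply: csmoothM; first exact: csmooth_cst.
  apply: csmooth_of_params => k.
  have := csmooth_coords_mx (param_pos k).1 (param_pos k).2 x; congr (csmooth _ x).
  by apply/funext => y; rewrite [RHS]mxE.
have := csmooth_neq0 sD; rewrite mulN1r => /(_ Dij).
apply: nearS => y; rewrite mulN1r => Dy /= E.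
by move: Dy; rewrite -E subrr eqxx.
Qed.

Lemma polynomial_at_of_params p i j :
  let f (y : 'rV[R]_(5 + 5)) := of_params (to_complex y) i j in
  polynomial_at (fun y => complex.Re (f y)) p /\ polynomial_at (fun y => complex.Im (f y)) p.
Proof.
move=> f; pose P (F : 'rV[R]_(5 + 5) -> C) :=
  polynomial_at (fun y => complex.Re (F y)) p /\ polynomial_at (fun y => complex.Im (F y)) p.
have Pz k : P (fun y => to_complex y 0 k).
  split.
    have [l El] := polynomial_at_coord (lshift 5 k) p; exists l => y; rewrite -El.
    by rewrite mxE.
  have [l El] := polynomial_at_coord (rshift 5 k) p; exists l => y; rewrite -El.
  by rewrite mxE.
apply: (@ambiguity_mx_closed _ P) => //.
- by split; exact: polynomial_at_cst.
- move=> F G [Fr Fi] [Gr Gi]; split.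
    have [l El] := polynomial_atD (polynomial_atM Fr Gr) (polynomial_atN (polynomial_atM Fi Gi)).
    by exists l => y; rewrite -El ReM.
  have [l El] := polynomial_atD (polynomial_atM Fr Gi) (polynomial_atM Fi Gr).
  by exists l => y; rewrite -El ImM.
- move=> F [Fr Fi]; split.
    by have [l El] := Fr; exists l => y; rewrite -El; case: (F y).
  by have [l El] := polynomial_atN Fi; exists l => y; rewrite -El; case: (F y).
Qed.

Lemma ambiguity_analytic_submanifold :
  analytic_submanifold 10 (@mx_coords R 5 @` ambiguity_group).
Proof.
move=> p _; pose phi (y : 'rV[R]_(5 + 5)) := mx_coords (of_params (to_complex y)).
pose psi x : 'rV[R]_(5 + 5) := of_complex (params (coords_mx x)).
pose V := [set y : 'rV[R]_(5 + 5) | to_complex y 0 i0 != 0].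
have psiK : cancel phi psi by move=> y; rewrite /psi /phi mx_coordsK of_paramsK to_complexK.
have phi_poly y k : polynomial_at (fun y => phi y 0 k) y.
  case: (splitP k) => l kl.
    have -> : k = lshift _ l by apply: val_inj.
    case/mxvec_indexP: l {kl} => i j; have [[r Er] _] := polynomial_at_of_params y i j.
    by exists r => x; rewrite -Er /phi /mx_coords row_mxEl mxE mxvecE.
  have -> : k = rshift (5 * 5) l by apply: val_inj.
  case/mxvec_indexP: l {kl} => i j; have [_ [r Er]] := polynomial_at_of_params y i j.
  by exists r => x; rewrite -Er /phi /mx_coords row_mxEr mxE mxvecE.
have dphi y k : differentiable (fun y => phi y 0 k) y.
  have := analytic_smooth (polynomial_analytic (phi_poly y k)).
  by move=> /smooth_differentiable/nbhs_singleton.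
have cpsi j x : csmooth (fun x => to_complex (psi x) 0 j) x.
  have := csmooth_coords_mx (param_pos j).1 (param_pos j).2 x; congr (csmooth _ x).
  by apply/funext => y; rewrite /psi of_complexK [RHS]mxE.
have dpsi x k : differentiable (fun x => psi x 0 k) x.
  case: (splitP k) => j kj.
    have [/smooth_differentiable/nbhs_singleton + _] := cpsi j x.
    have -> : k = lshift 5 j by apply: val_inj.
    by congr (differentiable _ x); apply/funext => y; rewrite mxE.
  have [_ /smooth_differentiable/nbhs_singleton] := cpsi j x.
  have -> : k = rshift 5 j by apply: val_inj.
  by congr (differentiable _ x); apply/funext => y; rewrite mxE.
have oV : open V.
  rewrite openE => y Vy; exact: csmooth_neq0 (csmooth_to_complex i0 y) Vy.
(* Differentiating [psi \o phi = id] gives the differential of [phi] a left inverse. *)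
have phi_immersion y v : 'D_v phi y = 0 -> v = 0.
  move=> Dv; have dphiy : differentiable phi y by exact: differentiable_rV.
  have dpsiy : differentiable psi (phi y) by exact: differentiable_rV.
  have := derive_comp v dphiy dpsiy; rewrite Dv derive0.
  have -> : psi \o phi = id by apply/funext => x /=; rewrite psiK.
  by rewrite derive_id.
have phi_image : phi @` V = @mx_coords R 5 @` ambiguity_group.
  apply/seteqP; split=> [_ [y Vy <-]|_ [A /ambiguity_groupE[a0 AE] <-]].
    exists (of_params (to_complex y)) => //; apply/ambiguity_groupE.
    by rewrite of_paramsK.
  exists (of_complex (params A)); first by rewrite /V /= of_complexK.
  by rewrite /phi of_complexK -AE.
have psi_continuous : continuous psi.
  by move=> x; apply: differentiable_continuous; exact: differentiable_rV.
(* A single chart covers the whole group, so it serves at every point [p]. *)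
exists setT, V, phi, psi; split.
- by split => //; exact: openT.
- by move=> y _ k; exact: polynomial_analytic.
- by move=> y _ v; exact: phi_immersion.
- by rewrite setIT phi_image.
- by split=> [|y _]; [exact: continuous_subspaceT|exact: psiK].
Qed.

End AmbiguityGroup.

Theorem proposition1p3 (R : realType) :
  (forall M' : set 'rV[R]_(4 + 4),
     analytic_submanifold 5 M' -> CR_generic M' -> maximally_minimal M' ->
   forall (U U' : set 'rV[R]_(4 + 4)) (h g : 'rV[R]_(4 + 4) -> 'rV[R]_(4 + 4)),
     biholomorphism U U' h g ->
     h @` (@cubic_model R `&` U) = M' `&` U' ->
   forall L L' : vfield R (4 + 4),
     T10_generator (@cubic_model R) U L -> T10_generator M' U' L' ->
   exists a b c d e : 'rV[R]_(4 + 4) -> R[i],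
     forall q, M' q -> U' q ->
       a q != 0 /\
       frame_mx (map_tuple (push_field h g) (frame (@cubic_model R) L)) q
       = ambiguity_mx (a q) (b q) (c q) (d q) (e q) *m frame_mx (frame M' L') q)
  /\
  matrix_lie_subgroup 10
    [set A : 'M[R[i]]_5 | exists a b c d e : R[i],
       a != 0 /\ A = ambiguity_mx a b c d e].
Proof.
split; last first.
  split; [exact: ambiguity_subgroup|exact: ambiguity_closed_in_GL|].
  exact: ambiguity_analytic_submanifold.
move=> M' _ _ mM' U U' h g bih hM L L' gL gL'.
(* The five numbers are packed in one row vector so that a single choice yields all five functions;
   off [M'] or [U'] the value is the arbitrary [0]. *)
have /choice[z zE] : forall q, exists z : 'rV[R[i]]_5, M' q -> U' q ->
    z 0 (inord 0) != 0 /\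
    frame_mx (map_tuple (push_field h g) (frame (@cubic_model R) L)) q
    = ambiguity_mx (z 0 (inord 0)) (z 0 (inord 1)) (z 0 (inord 2)) (z 0 (inord 3))
        (z 0 (inord 4)) *m frame_mx (frame M' L') q.
  move=> q; have [[Mq Uq]|nq] := pselect (M' q /\ U' q); last first.
    by exists 0 => Mq Uq; case: nq.
  have [a [b [c [d [e E]]]]] := frame_transition mM' bih hM gL gL' Mq Uq.
  by exists (\row_k nth 0 [:: a; b; c; d; e] k) => _ _; rewrite !mxE !inordK.
by exists (fun q => z q 0 (inord 0)), (fun q => z q 0 (inord 1)),
  (fun q => z q 0 (inord 2)), (fun q => z q 0 (inord 3)), (fun q => z q 0 (inord 4)).
Qed.
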